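(* Let $(P,Q)$ be a quasi-projection pair on a Hilbert $C^*$-module $\mathscr{H}$, and let $$\mathscr{M}=\overline{\mathcal{R}(T_1)}+\overline{\mathcal{R}(T_2)},$$ where $T_1=P(I-Q)$ and $T_2=(I-P)Q$. Then $(P|_{\mathscr{M}},Q|_{\mathscr{M}})$ is a semi-harmonious quasi-projection pair on $\mathscr{M}$.
   Context: $\mathfrak{A}$ is a $C^*$-algebra and $\mathscr{H}$ is a (right) Hilbert $\mathfrak{A}$-module; $\mathcal{L}(\mathscr{H})$ is the $C^*$-algebra of adjointable operators on $\mathscr{H}$, and $I$ is the identity operator on $\mathscr{H}$. For $T\in\mathcal{L}(\mathscr{H})$, $\mathcal{R}(T)$ and $T^*$ denote its range and adjoint, and $|T|=(T^*T)^{1/2}$; $T|_{\mathscr{M}}$ is the restriction of $T$ to $\mathscr{M}$; the bar denotes norm closure. An idempotent is $Q\in\mathcal{L}(\mathscr{H})$ with $Q^2=Q$; a projection is a self-adjoint idempotent. A closed submodule $\mathscr{M}$ of $\mathscr{H}$ is orthogonally complemented in $\mathscr{H}$ if $\mathscr{H}=\mathscr{M}+\mathscr{M}^\perp$; then $P_{\mathscr{M}}$ denotes the projection from $\mathscr{H}$ onto $\mathscr{M}$. $T\in\mathcal{L}(\mathscr{H})$ has the polar decomposition if there is a partial isometry $U\in\mathcal{L}(\mathscr{H})$ with $T=U|T|$ and $U^*U=P_{\overline{\mathcal{R}(T^* )}}$ (in particular $\overline{\mathcal{R}(T^* )}$ is orthogonally complemented). A quasi-projection pair $(P,Q)$ on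 $\mathscr{H}$ consists of a projection $P\in\mathcal{L}(\mathscr{H})$ and an idempotent $Q\in\mathcal{L}(\mathscr{H})$ such that $PQ^*P=PQP$, $PQ^*(I-P)=-PQ(I-P)$ and $(I-P)Q^*(I-P)=(I-P)Q(I-P)$; equivalently, $Q^*=(2P-I)Q(2P-I)$. A quasi-projection pair $(P,Q)$ is semi-harmonious if both $P(I-Q)$ and $(I-P)Q$ have the polar decomposition. These notions apply to any Hilbert $C^*$-module. In the claim, the assertion includes that $\mathscr{M}$ is a closed submodule of $\mathscr{H}$ (hence a Hilbert $\mathfrak{A}$-module), that $P|_{\mathscr{M}}$ and $Q|_{\mathscr{M}}$ map $\mathscr{M}$ into $\mathscr{M}$ and are elements of $\mathcal{L}(\mathscr{M})$. *)

(* Defs.v *)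
From HB Require Import structures.
From mathcomp Require Import all_boot all_order all_algebra.
From mathcomp Require Import boolp classical_sets functions reals topology normedtype.
From mathcomp Require Import complex.

Set Implicit Arguments.
Unset Strict Implicit.
Unset Printing Implicit Defensive.

Import Order.TTheory GRing.Theory Num.Theory.
Import numFieldTopology.Exports numFieldNormedType.Exports.

Local Open Scope classical_set_scope.
Local Open Scope ring_scope.

(** * C*-algebras over the complex field [R[i]]

    No unit is assumed, so the product is not the one of a MathComp ring. *)
HB.mixin Record CompleteNormedModule_isCStarAlgebra (R : realType) A
    & CompleteNormedModule R[i] A := {
  cmul : A -> A -> A ;
  cstar : A -> A ;
  cmulA : forall a b c, cmul a (cmul b c) = cmul (cmul a b) c ;
  cmulDl : forall a b c, cmul (a + b) c = cmul a c + cmul b c ;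
  cmulDr : forall a b c, cmul a (b + c) = cmul a b + cmul a c ;
  cmulZl : forall (k : R[i]) a b, cmul (k *: a) b = k *: cmul a b ;
  cmulZr : forall (k : R[i]) a b, cmul a (k *: b) = k *: cmul a b ;
  cstarK : forall a, cstar (cstar a) = a ;
  cstarD : forall a b, cstar (a + b) = cstar a + cstar b ;
  cstarZ : forall (k : R[i]) a, cstar (k *: a) = k^* *: cstar a ;
  cstarM : forall a b, cstar (cmul a b) = cmul (cstar b) (cstar a) ;
  cnorm_submul : forall a b, `|cmul a b| <= `|a| * `|b| ;
  cnorm_star_mul : forall a, `|cmul (cstar a) a| = `|a| ^+ 2
}.

#[short(type="cstarAlgType")]
HB.structure Definition CStarAlgebra (R : realType) :=
  {A of CompleteNormedModule R[i] A & CompleteNormedModule_isCStarAlgebra R A}.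

Definition cpositive (R : realType) (A : cstarAlgType R) (a : A) : Prop :=
  exists b : A, a = cmul (cstar b) b.

(** * Right Hilbert C*-modules

    The inner product is linear in its second argument.  The norm of the
    underlying Banach space is tied to the inner product by [hnormE], which
    also yields definiteness. *)
HB.mixin Record CompleteNormedModule_isHilbertModule
    (R : realType) (A : cstarAlgType R) H & CompleteNormedModule R[i] H := {
  hact : H -> A -> H ;
  hinner : H -> H -> A ;
  hactDl : forall x y a, hact (x + y) a = hact x a + hact y a ;
  hactDr : forall x a b, hact x (a + b) = hact x a + hact x b ;
  hactA : forall x a b, hact (hact x a) b = hact x (cmul a b) ;
  hactZl : forall (k : R[i]) x a, hact (k *: x) a = k *: hact x a ;
  hactZr : forall (k : R[i]) x a, hact x (k *: a) = k *: hact x a ;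
  hinnerDr : forall x y z, hinner x (y + z) = hinner x y + hinner x z ;
  hinnerZr : forall (k : R[i]) x y, hinner x (k *: y) = k *: hinner x y ;
  hinner_act : forall x y a, hinner x (hact y a) = cmul (hinner x y) a ;
  hinner_star : forall x y, cstar (hinner x y) = hinner y x ;
  hinner_ge0 : forall x, cpositive (hinner x x) ;
  hnormE : forall x, `|x| ^+ 2 = `|hinner x x|
}.

#[short(type="hilbertModType")]
HB.structure Definition HilbertModule (R : realType) (A : cstarAlgType R) :=
  {H of CompleteNormedModule R[i] H & CompleteNormedModule_isHilbertModule R A H}.

Section InnerProduct.
Context (R : realType) (A : cstarAlgType R) (H : hilbertModType A).
Implicit Types x y z : H.

Lemma hinnerNr x y : hinner x (- y) = - hinner x y.
Proof. by rewrite -scaleN1r hinnerZr scaleN1r. Qed.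

Lemma hinner0r x : hinner x 0 = 0.
Proof. by rewrite -(scale0r 0) hinnerZr scale0r. Qed.

Lemma hinnerDl x y z : hinner (x + y) z = hinner x z + hinner y z.
Proof. by rewrite -hinner_star hinnerDr cstarD !hinner_star. Qed.

Lemma hinnerZl k x y : hinner (k *: x) y = k^* *: hinner x y.
Proof. by rewrite -hinner_star hinnerZr cstarZ hinner_star. Qed.

Lemma hinnerNl x y : hinner (- x) y = - hinner x y.
Proof. by rewrite -scaleN1r hinnerZl rmorphN1 scaleN1r. Qed.

Lemma hinner0l x : hinner 0 x = 0.
Proof. by rewrite -(scale0r 0) hinnerZl rmorph0 scale0r. Qed.

Lemma hinner_eq0 x : hinner x x = 0 -> x = 0.
Proof.
by move=> x0; apply/normr0_eq0/eqP; rewrite -sqrf_eq0 hnormE x0 normr0.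
Qed.

Lemma hinner_inj x y : (forall z, hinner z x = hinner z y) -> x = y.
Proof.
move=> xy; apply/eqP; rewrite -subr_eq0; apply/eqP/hinner_eq0.
by rewrite hinnerDr hinnerNr xy subrr.
Qed.

End InnerProduct.

(** * The *-algebra of adjointable operators *)
Section Adjointable.
Context (R : realType) (A : cstarAlgType R) (H : hilbertModType A).

Definition is_adjoint (f g : H -> H) : Prop :=
  forall x y, hinner (f x) y = hinner x (g y).

Definition adjointable : {pred H -> H} :=
  fun f => `[< exists g, is_adjoint f g >].

Lemma is_adjoint_sym f g : is_adjoint f g -> is_adjoint g f.
Proof. by move=> fg x y; rewrite -hinner_star -fg hinner_star. Qed.

Lemma is_adjoint_additive f g : is_adjoint f g -> {morph f : x y / x + y}.
Proof.
move=> fg x y; apply: hinner_inj => z; have gf := is_adjoint_sym fg.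
by rewrite -gf !hinnerDr !gf.
Qed.

Lemma adjointable_zmod_closed : zmod_closed adjointable.
Proof.
split=> [|f g /asboolP[f' ff'] /asboolP[g' gg']]; apply/asboolP.
  by exists (fun=> 0) => x y; rewrite hinner0l hinner0r.
exists (f' - g') => x y.
by rewrite !fctE hinnerDl hinnerNl hinnerDr hinnerNr ff' gg'.
Qed.

HB.instance Definition _ :=
  GRing.isZmodClosed.Build (H -> H) adjointable adjointable_zmod_closed.

Record adjop := AdjOp { adjop_fun :> H -> H ; _ : adjop_fun \in adjointable }.

HB.instance Definition _ := [isSub for adjop_fun].
HB.instance Definition _ := [Choice of adjop by <:].
HB.instance Definition _ := [SubChoice_isSubZmodule of adjop by <:].

Lemma adjopP (S T : adjop) : (forall x, S x = T x) -> S = T.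
Proof. by move=> ST; apply/val_inj/funext. Qed.

Lemma adjop_ex (T : adjop) : exists g, is_adjoint T g.
Proof. by apply/asboolP; case: T. Qed.

Lemma adjop_add (T : adjop) : {morph T : x y / x + y}.
Proof. by have [g] := adjop_ex T; exact: is_adjoint_additive. Qed.

Lemma adjop_id_subproof : (@idfun H) \in adjointable.
Proof. by apply/asboolP; exists idfun. Qed.

Lemma adjop_comp_subproof (S T : adjop) : (S \o T) \in adjointable.
Proof.
apply/asboolP; have [S' SS'] := adjop_ex S; have [T' TT'] := adjop_ex T.
by exists (T' \o S') => x y /=; rewrite SS' TT'.
Qed.

Definition adjop_id := AdjOp adjop_id_subproof.
Definition adjop_comp (S T : adjop) := AdjOp (adjop_comp_subproof S T).

Lemma adjop_compA : associative adjop_comp.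
Proof. by move=> S T U; apply: adjopP. Qed.
Lemma adjop_comp1l : left_id adjop_id adjop_comp.
Proof. by move=> T; apply: adjopP. Qed.
Lemma adjop_comp1r : right_id adjop_id adjop_comp.
Proof. by move=> T; apply: adjopP. Qed.
Lemma adjop_compDl : left_distributive adjop_comp +%R.
Proof. by move=> S T U; apply: adjopP. Qed.
Lemma adjop_compDr : right_distributive adjop_comp +%R.
Proof. by move=> S T U; apply: adjopP => x; exact: adjop_add. Qed.

(* In the ring of adjointable operators, [S * T] is composition and [1] is the
   identity. *)
HB.instance Definition _ := GRing.Zmodule_isPzRing.Build adjop
  adjop_compA adjop_comp1l adjop_comp1r adjop_compDl adjop_compDr.

Lemma adj_subproof (T : adjop) : projT1 (cid (adjop_ex T)) \in adjointable.
Proof.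
apply/asboolP; exists T; apply: is_adjoint_sym.
exact: projT2 (cid (adjop_ex T)).
Qed.

Definition adj (T : adjop) : adjop := AdjOp (adj_subproof T).

Lemma adjE (T : adjop) x y : hinner (T x) y = hinner x (adj T y).
Proof. exact: projT2 (cid (adjop_ex T)) x y. Qed.

End Adjointable.

Arguments adjop {R A} H.

(** * Closed submodules as Hilbert modules *)
Section Submodule.
Context (R : realType) (A : cstarAlgType R) (H : hilbertModType A).

Record closed_submodule (M : set H) : Prop := {
  csub_closed : closed M ;
  csub0 : M 0 ;
  csubD : forall x y, M x -> M y -> M (x + y) ;
  csubZ : forall (k : R[i]) x, M x -> M (k *: x) ;
  csub_act : forall x (a : A), M x -> M (hact x a)
}.

Variables (M : set H) (hM : closed_submodule M).

Definition in_csub (_ : closed_submodule M) : {pred H} := mem M.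

Lemma in_csub_submod_closed : submod_closed (in_csub hM).
Proof.
split; first exact/mem_set/(csub0 hM).
by move=> k x y /set_mem Mx /set_mem My;
  apply/mem_set/(csubD hM) => //; exact: (csubZ hM).
Qed.

HB.instance Definition _ :=
  GRing.isSubmodClosed.Build R[i] H (in_csub hM) in_csub_submod_closed.

Record csub := CSub { csub_val :> H ; _ : csub_val \in in_csub hM }.

HB.instance Definition _ := [isSub for csub_val].
HB.instance Definition _ := [Choice of csub by <:].
HB.instance Definition _ := [SubChoice_isSubLmodule of csub by <:].

Lemma csubP (x : csub) : M x.
Proof. by case: x => x /= xM; exact: set_mem xM. Qed.

Lemma csub_norm_eq0 (x : csub) : `|csub_val x| = 0 -> x = 0.
Proof. by move=> /normr0_eq0 x0; exact: val_inj. Qed.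

HB.instance Definition _ := Lmodule_isNormed.Build R[i] csub
  (norm := fun x => `|csub_val x|)
  (fun x y => ler_normD (csub_val x) (csub_val y))
  (fun k x => normrZ k (csub_val x)) csub_norm_eq0.

Lemma csub_complete (F : set_system csub) :
  ProperFilter F -> cauchy F -> cvg F.
Proof.
move=> FF /cauchy_ballP Fc.
have Gc : cauchy (csub_val @ F).
  apply/cauchy_ballP => e e0; rewrite near_map2.
  by have := Fc e e0; rewrite -!ball_normE.
have Gl : cvg (csub_val @ F) by exact: cauchy_cvg Gc.
have Ml : M (lim (csub_val @ F)).
  have FM : \forall x \near F, M (csub_val x) by apply: nearW; exact: csubP.
  exact: (closed_cvg M (csub_closed hM) FM _ Gl).
apply/cvg_ex; exists (CSub (mem_set Ml : _ \in in_csub hM)).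
apply/cvgrPdist_lt => e e0.
by move/cvgrPdist_lt : Gl => /(_ e e0).
Qed.

HB.instance Definition _ := Uniform_isComplete.Build csub csub_complete.

Lemma csub_act_subproof (x : csub) (a : A) : hact (csub_val x) a \in in_csub hM.
Proof. exact/mem_set/(csub_act hM)/csubP. Qed.

Definition csub_hact (x : csub) (a : A) : csub := CSub (csub_act_subproof x a).
Definition csub_hinner (x y : csub) : A := hinner (csub_val x) (csub_val y).

Lemma csub_hactDl x y a : csub_hact (x + y) a = csub_hact x a + csub_hact y a.
Proof. by apply: val_inj; exact: hactDl. Qed.

Lemma csub_hactDr x a b : csub_hact x (a + b) = csub_hact x a + csub_hact x b.
Proof. by apply: val_inj; exact: hactDr. Qed.

Lemma csub_hactA x a b : csub_hact (csub_hact x a) b = csub_hact x (cmul a b).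
Proof. by apply: val_inj; exact: hactA. Qed.

Lemma csub_hactZl (k : R[i]) x a : csub_hact (k *: x) a = k *: csub_hact x a.
Proof. by apply: val_inj; exact: hactZl. Qed.

Lemma csub_hactZr (k : R[i]) x a : csub_hact x (k *: a) = k *: csub_hact x a.
Proof. by apply: val_inj; exact: hactZr. Qed.

HB.instance Definition _ :=
  CompleteNormedModule_isHilbertModule.Build R A csub
    csub_hactDl csub_hactDr csub_hactA csub_hactZl csub_hactZr
    (fun x y z : csub => hinnerDr (csub_val x) (csub_val y) (csub_val z))
    (fun k (x y : csub) => hinnerZr k (csub_val x) (csub_val y))
    (fun (x y : csub) a => hinner_act (csub_val x) (csub_val y) a)
    (fun x y : csub => hinner_star (csub_val x) (csub_val y))
    (fun x : csub => hinner_ge0 (csub_val x))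
    (fun x : csub => hnormE (csub_val x)).

End Submodule.

(** * Projections, polar decomposition and quasi-projection pairs *)
Section Operators.
Context (R : realType) (A : cstarAlgType R) (H : hilbertModType A).
Implicit Types (M : set H) (E P Q T U : adjop H).

Definition orthocompl M : set H := [set x | forall y, M y -> hinner y x = 0].

Definition orthocomplemented M : Prop :=
  forall x, exists y z, [/\ M y, orthocompl M z & x = y + z].

Definition is_idempotent Q : Prop := Q * Q = Q.

Definition is_projection P : Prop := is_idempotent P /\ adj P = P.

(* [E] is the projection P_M; this includes that M is a closed, orthogonally
   complemented submodule. *)
Definition is_projection_onto M E : Prop :=
  [/\ closed_submodule M, orthocomplemented M, is_projection E & range E = M].

Definition op_positive T : Prop := exists S : adjop H, T = adj S * S.

(* [B] is |T|, the positive square root of [adj T * T]. *)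
Definition is_abs T B : Prop := op_positive B /\ B * B = adj T * T.

Definition partial_isometry U : Prop := is_projection (adj U * U).

Definition has_polar_decomposition T : Prop :=
  exists U absT : adjop H,
    [/\ is_abs T absT, partial_isometry U, T = U * absT &
        is_projection_onto (closure (range (adj T))) (adj U * U)].

Definition quasi_projection_pair P Q : Prop :=
  [/\ is_projection P, is_idempotent Q &
   [/\ P * adj Q * P = P * Q * P,
       P * adj Q * (1 - P) = - (P * Q * (1 - P)) &
       (1 - P) * adj Q * (1 - P) = (1 - P) * Q * (1 - P)]].

Definition semi_harmonious P Q : Prop :=
  [/\ quasi_projection_pair P Q,
      has_polar_decomposition (P * (1 - Q)) &
      has_polar_decomposition ((1 - P) * Q)].

(* [S] is the restriction of [T] to the closed submodule [M]: its existence
   says that [T] maps [M] into [M] and that the restriction is adjointable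
   on [M]. *)
Definition is_restriction M (hM : closed_submodule M) T (S : adjop (csub hM)) :
    Prop :=
  forall x : csub hM, (S x : H) = T x.

End Operators.

(* Main.v *)
Require Import Defs.
From HB Require Import structures.
From mathcomp Require Import all_boot all_order all_algebra.
From mathcomp Require Import boolp classical_sets functions reals topology normedtype.
From mathcomp Require Import sequences complex ring lra.

(** Write [T1 = P * (1 - Q)] and [T2 = (1 - P) * Q], and let [a] and [d] be the
    diagonal blocks of [Q] along [P].  A quasi-projection pair is one for which
    [a] and [d] are self-adjoint and the off-diagonal blocks are opposite adjoints
    of each other.

    The submodule consists of the vectors [z] with [P z] in the closure of the
    range of [T1] and [(1 - P) z] in the closure of the range of [T2]
    ([harmonic_partE]).  Block computations such as [P Q T1 = T1 (1 - T1)] show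
    that [Q] maps both ranges into it, and [adj Q * P = 2 P Q P - Q P] transfers
    this to [adj Q] ([harmonic_part_Q], [harmonic_part_adjQ]).  Hence [P] and [Q]
    restrict to adjointable operators whose adjoints are the restrictions of
    [adj P] and [adj Q], and the defining equations of the pair are inherited.

    An adjointable [T] has a polar decomposition as soon as
    [range T + ker (adj T)] and [range (adj T) + ker T] are dense
    ([polar_of_dense]).  For the restriction of [T1] the first density is a
    consequence of the density of the range of [T1 * adj T1] in that of [T1].
    The second one rests on the identity
    [T1 * adj T1 = (adj T1 - Q) * (T1 * P)], which in blocks is the factorization
    [1 - 3 a + 2 a^2 = (1 - 2 a) (1 - a)], together with [T1 * Q = 0]: it shows
    that the closure of the range of [T1] consists of limits of sums of vectors
    in the range of [adj T1] and in the kernel of [T1] ([offdiag_range_approx]).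
    The remaining component is reached through [Q u = P (Q u) + T2 u].  The
    operator [T2] is treated by the symmetry that exchanges [(P, Q)] with
    [(1 - P, 1 - Q)].

    The construction of [|T|] in [polar_of_dense] requires that [adj T * T] be
    positive in the C*-algebra of adjointable operators ([nonneg_adjM]), a theorem
    of Kelley, Vaught and Kaplansky.  The functional calculus that it uses reduces
    to two power series in a self-adjoint operator, the square root of [1 - y] and
    the Neumann series.  Sharp norm estimates come from one principle: a
    self-adjoint operator with bounded powers is the real part of a unitary, and
    unitaries are isometric ([selfadj_contraction]). *)

Set Implicit Arguments.
Unset Strict Implicit.
Unset Printing Implicit Defensive.

Import Order.TTheory GRing.Theory Num.Theory.
Import numFieldTopology.Exports numFieldNormedType.Exports.

Local Open Scope classical_set_scope.
Local Open Scope complex_scope.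
Local Open Scope ring_scope.

(** * Linear identities in abelian groups *)

(** Operators do not commute, so identities between them are proved by expanding
    products and comparing the resulting sums of words as elements of a free
    abelian group: an expression is determined by the integer coefficients of
    its atoms. *)
Inductive zexpr := ZVar of nat | ZAdd of zexpr & zexpr | ZOpp of zexpr | ZZero.

Fixpoint zinterp (V : zmodType) (env : seq V) e : V :=
  match e with
  | ZVar n => nth 0 env n
  | ZAdd e f => zinterp env e + zinterp env f
  | ZOpp e => - zinterp env e
  | ZZero => 0
  end.

Fixpoint zcoef e (n : nat) : int :=
  match e with
  | ZVar m => (m == n)%:Z
  | ZAdd e f => zcoef e n + zcoef f n
  | ZOpp e => - zcoef e n
  | ZZero => 0
  end.

Lemma zinterpE (V : zmodType) (env : seq V) e :
  zinterp env e = \sum_(i < size env) nth 0 env i *~ zcoef e i.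
Proof.
elim: e => [n|e IHe f IHf|e IHe|] /=.
- have [n_lt|n_ge] := ltnP n (size env); last first.
    rewrite nth_default // big1 // => i _.
    by rewrite gtn_eqF ?mulr0z // (leq_trans (ltn_ord i)).
  rewrite (bigD1 (Ordinal n_lt)) //= eqxx mulr1z big1 ?addr0 // => i.
  by rewrite -val_eqE /= eq_sym => /negPf ->; rewrite mulr0z.
- by rewrite IHe IHf -big_split; apply: eq_bigr => i _; rewrite mulrzDr.
- by rewrite IHe -sumrN; apply: eq_bigr => i _; rewrite mulrNz.
- by rewrite big1 // => i _; rewrite mulr0z.
Qed.

Lemma zexprP (V : zmodType) (env : seq V) e f :
  all (fun i => zcoef e i == zcoef f i) (iota 0 (size env)) ->
  zinterp env e = zinterp env f.
Proof.
move=> /allP ef; rewrite !zinterpE; apply: eq_bigr => i _.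
by rewrite (eqP (ef i _)) ?mem_iota ?ltn_ord.
Qed.

(* Atoms are compared up to conversion because the same operator product may be
   presented through different ring structures. *)
Ltac zmem x env :=
  lazymatch env with
  | nil => constr:(false)
  | ?y :: ?env' =>
    match constr:(Set) with
    | _ => let _ := match constr:(Set) with _ => unify x y end in constr:(true)
    | _ => zmem x env'
    end
  end.

Ltac zindex x env :=
  lazymatch env with
  | ?y :: ?env' =>
    match constr:(Set) with
    | _ => let _ := match constr:(Set) with _ => unify x y end in constr:(0%N)
    | _ => let n := zindex x env' in constr:(S n)
    end
  end.

Ltac zatoms t env :=
  lazymatch t with
  | (?a + ?b)%R => let env1 := zatoms a env in zatoms b env1
  | (- ?a)%R => zatoms a env
  | 0%R => env
  | _ => let m := zmem t env in
    lazymatch m with true => env | false => constr:(t :: env) end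
  end.

Ltac zreify t env :=
  lazymatch t with
  | (?a + ?b)%R =>
    let e := zreify a env in let f := zreify b env in constr:(ZAdd e f)
  | (- ?a)%R => let e := zreify a env in constr:(ZOpp e)
  | 0%R => constr:(ZZero)
  | _ => let n := zindex t env in constr:(ZVar n)
  end.

Ltac zmod :=
  rewrite ?mulr2n;
  lazymatch goal with
  | |- @eq ?T ?l ?r =>
    let env1 := zatoms l (@nil T) in
    let env := zatoms r env1 in
    let e := zreify l env in
    let f := zreify r env in
    refine (@zexprP _ env e f _); reflexivity
  end.

(** * Real-valued norms *)

Section RealNorm.
Context (R : realType) (V : normedModType R[i]).
Implicit Types x y : V.

(** The norm of a complex normed module takes values in [R[i]], which is only
    partially ordered; its real part carries the same information and lives in
    a totally ordered field. *)
Definition rnorm x : R := complex.Re `|x|.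

Lemma rnormE x : `|x| = (rnorm x)%:C.
Proof. by rewrite RRe_real // ger0_real. Qed.

Lemma rnorm_ge0 x : 0 <= rnorm x.
Proof. by rewrite -ler0c -rnormE. Qed.

Lemma rnormD x y : rnorm (x + y) <= rnorm x + rnorm y.
Proof. by rewrite -lecR rmorphD /= -!rnormE ler_normD. Qed.

Lemma rnormN x : rnorm (- x) = rnorm x.
Proof. by rewrite /rnorm normrN. Qed.

Lemma rnormB x y : rnorm (x - y) <= rnorm x + rnorm y.
Proof. by rewrite -(rnormN y) rnormD. Qed.

Lemma rnormBC x y : rnorm (x - y) = rnorm (y - x).
Proof. by rewrite -rnormN opprB. Qed.

Lemma rnorm0 : rnorm 0 = 0.
Proof. by rewrite /rnorm normr0. Qed.

Lemma rnorm_eq0 x : rnorm x = 0 -> x = 0.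
Proof. by move=> x0; apply/normr0_eq0; rewrite rnormE x0. Qed.

Lemma norm_realC (k : R) : `|k%:C| = `|k|%:C.
Proof. by rewrite normc_def /= expr0n addr0 sqrtr_sqr. Qed.

Lemma rnormZ (k : R) x : rnorm (k%:C *: x) = `|k| * rnorm x.
Proof. by apply: complexI; rewrite rmorphM /= -rnormE normrZ norm_realC -rnormE. Qed.

Lemma rnormZi x : rnorm ('i *: x) = rnorm x.
Proof.
by rewrite /rnorm normrZ normc_def /= expr0n add0r expr1n sqrtr1 mul1r.
Qed.

Lemma cvg_rnormP (u : nat -> V) l :
  (u @ \oo --> l) <->
  (forall e : R, 0 < e -> exists N, forall n, (N <= n)%N -> rnorm (u n - l) < e).
Proof.
split=> [/cvgrPdist_lt ul e e0 | ul].
  have e0' : 0 < e%:C by rewrite ltcR.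
  have [N _ uN] := ul _ e0'; exists N => n Nn.
  by rewrite -ltcR -rnormE distrC; exact: uN.
apply/cvgrPdist_lt => e e0.
have eE : e = (complex.Re e)%:C by rewrite RRe_real // gtr0_real.
move: e0; rewrite eE ltcR => /ul[N uN]; exists N => // n /= Nn.
by rewrite distrC rnormE ltcR; exact: uN.
Qed.

Lemma seq_cvgD (u v : nat -> V) (l m : V) :
  u @ \oo --> l -> v @ \oo --> m -> u n + v n @[n --> \oo] --> l + m.
Proof. by move=> ul vm; exact: cvgD. Qed.

Lemma seq_cvg_unique (u : nat -> V) (l m : V) :
  u @ \oo --> l -> u @ \oo --> m -> l = m.
Proof. by move=> ul um; apply: cvg_unique ul um. Qed.

Lemma closure_rnormP (D : set V) x :
  closure D x <-> (forall e : R, 0 < e -> exists2 y, D y & rnorm (x - y) < e).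
Proof.
split=> [Dx e e0 | Dx].
  have e0' : 0 < e%:C by rewrite ltcR.
  have [y [Dy xy]] := Dx _ (nbhsx_ballx x _ e0').
  by exists y => //; rewrite -ltcR -rnormE; move: xy; rewrite -ball_normE.
move=> B /nbhs_ballP[e /= e0 eB].
have eE : e = (complex.Re e)%:C by rewrite RRe_real // gtr0_real.
move: (e0); rewrite {1}eE ltcR => /Dx[y Dy xy]; exists y; split=> //.
by apply: eB; rewrite -ball_normE /= rnormE eE ltcR.
Qed.

End RealNorm.

Section Complete.
Context (R : realType) (V : completeNormedModType R[i]).

Lemma rnorm_complete (u : nat -> V) :
  (forall e : R, 0 < e -> exists N, forall n, (N <= n)%N -> rnorm (u n - u N) < e) ->
  exists l : V, u @ \oo --> l.
Proof.
move=> uc; suff: cvg (u @ \oo) by move/cvg_ex.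
suff: cauchy (u @ \oo) by exact: cauchy_cvg.
suff: cauchy_ex (u @ \oo) by exact: cauchy_exP.
move=> e e0; rewrite /fmapE.
have eE : e = (complex.Re e)%:C by rewrite RRe_real // gtr0_real.
move: (e0); rewrite {1}eE ltcR => /uc[N uN]; exists (u N); exists N => // n /= Nn.
by rewrite -ball_normE /= rnormE eE ltcR rnormBC; exact: uN.
Qed.

End Complete.

(** * The inner product and the algebra of adjointable operators *)

Lemma conj_realC (R : realType) (k : R) : (k%:C)^* = k%:C.
Proof. exact: conjc_real. Qed.

Section InnerBound.
Context (R : realType) (A : cstarAlgType R) (H : hilbertModType A).
Implicit Types x y : H.

Lemma rnorm_inner x : rnorm (hinner x x) = rnorm x ^+ 2.
Proof. by apply: complexI; rewrite rmorphXn /= -!rnormE -hnormE. Qed.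

(** The square of the left-hand side is the norm of
    [cstar a * hinner x x * a], so submultiplicativity suffices once [cstar] is
    known to be contractive, which is the C*-identity applied to [cstar a]. *)
Lemma rnorm_hact x a : rnorm (hact x a) <= rnorm x * rnorm a.
Proof.
rewrite -(ler_pXn2r (_ : 0 < 2)%N) ?nnegrE ?mulr_ge0 ?rnorm_ge0 //.
rewrite -rnorm_inner hinner_act -hinner_star hinner_act cstarM hinner_star.
have le_cmul (b c : A) : rnorm (cmul b c) <= rnorm b * rnorm c.
  by rewrite -lecR rmorphM /= -!rnormE cnorm_submul.
have star_le (b : A) : rnorm (cstar b) <= rnorm b.
  have [b0|b0] := leP (rnorm (cstar b)) 0; first exact: le_trans b0 (rnorm_ge0 _).
  have : rnorm (cstar b) ^+ 2 <= rnorm b * rnorm (cstar b).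
    have -> : rnorm (cstar b) ^+ 2 = rnorm (cmul (cstar (cstar b)) (cstar b)).
      by apply: complexI; rewrite rmorphXn /= -!rnormE cnorm_star_mul.
    by rewrite cstarK le_cmul.
  by rewrite expr2 ler_pM2r.
apply: le_trans (le_cmul _ _) _.
rewrite exprMn -rnorm_inner mulrC [leRHS]mulrC expr2 -mulrA.
rewrite ler_wpM2l ?rnorm_ge0 //.
apply: le_trans (le_cmul _ _) _.
by rewrite ler_wpM2r ?rnorm_ge0 //.
Qed.

Lemma polarization x y :
  hinner x y *+ 4 = hinner (x + y) (x + y) - hinner (x - y) (x - y)
    - 'i *: (hinner (x + 'i *: y) (x + 'i *: y)
             - hinner (x - 'i *: y) (x - 'i *: y)).
Proof.
have diff u v : hinner (u + v) (u + v) - hinner (u - v) (u - v) =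
    (hinner u v + hinner v u) *+ 2 :> A.
  by rewrite !hinnerDl !hinnerDr !hinnerNl !hinnerNr; zmod.
rewrite !diff hinnerZr hinnerZl -scalerMnr scalerDr !scalerA conjCi.
rewrite mulrN -expr2 sqrCi opprK scaleN1r scale1r.
by rewrite (_ : 4 = 2 * 2)%N // mulrnA; zmod.
Qed.

(** A weak Cauchy-Schwarz inequality: polarization bounds the inner product of
    two unit vectors by norms of at most 2, and homogeneity does the rest.  The
    constant 4 is harmless below, where inner products only serve to establish
    continuity and boundedness. *)
Lemma rnorm_inner_le x y : rnorm (hinner x y) <= 4 * rnorm x * rnorm y.
Proof.
have rnormMn (V : normedModType R[i]) (v : V) n : rnorm (v *+ n) = n%:R * rnorm v.
  by rewrite -scaler_nat -(rmorph_nat (real_complex R)) rnormZ normr_nat.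
have le_sq (u v : H) : rnorm (hinner u v) <= (rnorm u + rnorm v) ^+ 2.
  have sq_le (w : H) : rnorm w <= rnorm u + rnorm v ->
      rnorm (hinner w w) <= (rnorm u + rnorm v) ^+ 2.
    by move=> wuv; rewrite rnorm_inner lerXn2r ?nnegrE ?addr_ge0 ?rnorm_ge0.
  rewrite -(ler_pM2l (_ : 0 < 4%:R)) // -rnormMn polarization.
  apply: le_trans (rnormB _ _) _; rewrite rnormZi.
  apply: le_trans (lerD (rnormB _ _) (rnormB _ _)) _.
  have := sq_le _ (rnormD u v); have := sq_le _ (rnormB u v).
  have := sq_le (u + 'i *: v); rewrite (le_trans (rnormD _ _)) ?rnormZi // => /(_ isT).
  have := sq_le (u - 'i *: v); rewrite (le_trans (rnormB _ _)) ?rnormZi // => /(_ isT).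
  lra.
have [/eqP x0|x0] := eqVneq (rnorm x) 0.
  by move: x0 => /eqP/rnorm_eq0 ->; rewrite hinner0l !rnorm0 mulr0 mul0r.
have [/eqP y0|y0] := eqVneq (rnorm y) 0.
  by move: y0 => /eqP/rnorm_eq0 ->; rewrite hinner0r !rnorm0 mulr0.
have x_gt0 : 0 < rnorm x by rewrite lt_def x0 rnorm_ge0.
have y_gt0 : 0 < rnorm y by rewrite lt_def y0 rnorm_ge0.
have := le_sq ((rnorm x)^-1%:C *: x) ((rnorm y)^-1%:C *: y).
rewrite hinnerZr hinnerZl conj_realC !rnormZ !ger0_norm ?invr_ge0 ?rnorm_ge0 //.
rewrite !mulVf // -mulrA mulrA -invfM ler_pdivrMl ?mulr_gt0 //.
lra.
Qed.

End InnerBound.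

Section AdjointAlgebra.
Context (R : realType) (A : cstarAlgType R) (H : hilbertModType A).
Implicit Types (S T U : adjop H) (x y : H).

Lemma adj_unique T S : is_adjoint T S -> adj T = S.
Proof.
by move=> TS; apply: adjopP => y; apply: hinner_inj => x; rewrite -adjE TS.
Qed.

Lemma adjK T : adj (adj T) = T.
Proof. by apply: adj_unique; apply: is_adjoint_sym => x y; rewrite adjE. Qed.

Lemma adjEr T x y : hinner (adj T x) y = hinner x (T y).
Proof. by rewrite adjE adjK. Qed.

Lemma adjM S T : adj (S * T) = adj T * adj S.
Proof. by apply: adj_unique => x y; rewrite /= !adjE. Qed.

Lemma adjD S T : adj (S + T) = adj S + adj T.
Proof. by apply: adj_unique => x y /=; rewrite hinnerDl hinnerDr !adjE. Qed.

Lemma adjN T : adj (- T) = - adj T.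
Proof. by apply: adj_unique => x y /=; rewrite hinnerNl hinnerNr !adjE. Qed.

Lemma adjB S T : adj (S - T) = adj S - adj T.
Proof. by rewrite adjD adjN. Qed.

Lemma adj1 : adj 1 = 1 :> adjop H.
Proof. exact: adj_unique. Qed.

Lemma adj0 : adj 0 = 0 :> adjop H.
Proof. by apply: adj_unique => x y; rewrite hinner0l hinner0r. Qed.

Lemma adjopDE S T x : (S + T) x = S x + T x. Proof. by []. Qed.
Lemma adjopBE S T x : (S - T) x = S x - T x. Proof. by []. Qed.
Lemma adjopNE T x : (- T) x = - T x. Proof. by []. Qed.
Lemma adjopME S T x : (S * T) x = S (T x). Proof. by []. Qed.
Lemma adjop1E x : (1 : adjop H) x = x. Proof. by []. Qed.

Lemma adjopZ T k x : T (k *: x) = k *: T x.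
Proof. by apply: hinner_inj => y; rewrite -adjEr !hinnerZr adjEr. Qed.

Lemma adjop0 T : T 0 = 0.
Proof. by have := adjopZ T 0 0; rewrite !scale0r. Qed.

Lemma adjopN T x : T (- x) = - T x.
Proof. by rewrite -scaleN1r adjopZ scaleN1r. Qed.

Lemma adjopB T x y : T (x - y) = T x - T y.
Proof. by rewrite adjop_add adjopN. Qed.

Lemma adjop_hact T x a : T (hact x a) = hact (T x) a.
Proof. by apply: hinner_inj => y; rewrite -adjEr !hinner_act adjEr. Qed.

(** The operators form a complex vector space.  As [H] may be the zero module,
    they do not form an algebra over [R[i]] in the sense of nontrivial rings, and
    compatibility of scaling with products is stated separately. *)
Lemma adjop_scale_subproof k T : (fun x => k *: T x) \in @adjointable R A H.
Proof.
apply/asboolP; exists (fun x => k^* *: adj T x) => x y.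
by rewrite hinnerZl hinnerZr adjE.
Qed.

Definition adjop_scale k T : adjop H := AdjOp (adjop_scale_subproof k T).

Lemma adjop_scaleA k l T :
  adjop_scale k (adjop_scale l T) = adjop_scale (k * l) T.
Proof. by apply: adjopP => x /=; rewrite scalerA. Qed.
Lemma adjop_scale1 : left_id 1 adjop_scale.
Proof. by move=> T; apply: adjopP => x /=; rewrite scale1r. Qed.
Lemma adjop_scaleDr : right_distributive adjop_scale +%R.
Proof. by move=> k S T; apply: adjopP => x /=; rewrite scalerDr. Qed.
Lemma adjop_scaleDl T : {morph adjop_scale^~ T : k l / k + l}.
Proof. by move=> k l; apply: adjopP => x /=; rewrite scalerDl. Qed.

HB.instance Definition _ := GRing.Zmodule_isLmodule.Build R[i] (adjop H)
  adjop_scaleA adjop_scale1 adjop_scaleDr adjop_scaleDl.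

Lemma adjopZE k T x : (k *: T) x = k *: T x. Proof. by []. Qed.

Lemma adjZ k T : adj (k *: T) = k^* *: adj T.
Proof. by apply: adj_unique => x y /=; rewrite hinnerZl hinnerZr adjE. Qed.

Lemma adjZr (k : R) T : adj (k%:C *: T) = k%:C *: adj T.
Proof. by rewrite adjZ conj_realC. Qed.

Lemma adjop_scalerAl k S T : k *: (S * T) = (k *: S) * T.
Proof. exact: adjopP. Qed.

Lemma adjop_scalerAr k S T : k *: (S * T) = S * (k *: T).
Proof. by apply: adjopP => x /=; rewrite adjopZ. Qed.

End AdjointAlgebra.

(** * Boundedness of adjointable operators *)

Section RestrictScalars.
Context (R : realType).

(** The underlying real Banach space of a complex one, to which the uniform
    boundedness principle over the reals applies. *)
Definition realmod (V : normedModType R[i]) : Type := V.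

Section Instances.
Context (V : normedModType R[i]).

HB.instance Definition _ := GRing.Zmodule.on (realmod V).

Lemma realmod_scaleA (k l : R) (x : realmod V) :
  k%:C *: (l%:C *: (x : V)) = (k * l)%:C *: (x : V).
Proof. by rewrite scalerA rmorphM. Qed.
Lemma realmod_scale1 (x : realmod V) : 1%:C *: (x : V) = x.
Proof. exact: scale1r. Qed.
Lemma realmod_scaleDr (k : R) (x y : realmod V) :
  k%:C *: (x + y : V) = k%:C *: (x : V) + k%:C *: (y : V).
Proof. exact: scalerDr. Qed.
Lemma realmod_scaleDl (x : realmod V) (k l : R) :
  (k + l)%:C *: (x : V) = k%:C *: (x : V) + l%:C *: (x : V).
Proof. by rewrite rmorphD scalerDl. Qed.

HB.instance Definition _ := GRing.Zmodule_isLmodule.Build R (realmod V)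
  realmod_scaleA realmod_scale1 realmod_scaleDr realmod_scaleDl.

HB.instance Definition _ := Lmodule_isNormed.Build R (realmod V)
  (norm := fun x : realmod V => rnorm (x : V))
  (fun x y => rnormD (x : V) y) (fun k x => rnormZ k (x : V)) (@rnorm_eq0 R V).

End Instances.

Section Completeness.
Context (V : completeNormedModType R[i]).

Lemma realmod_complete (F : set_system (realmod V)) :
  ProperFilter F -> cauchy F -> cvg F.
Proof.
move=> FF /cauchy_ballP Fc.
have ballE (e : R) (x y : V) :
    ball (x : realmod V) e (y : realmod V) <-> ball x e%:C y.
  by rewrite -!ball_normE /= [in X in _ <-> X]rnormE ltcR.
have realE (e : R[i]) : 0 < e -> exists2 r : R, 0 < r & e = r%:C.
  move=> e0; have eE : e = (complex.Re e)%:C by rewrite RRe_real // gtr0_real.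
  by exists (complex.Re e) => //; rewrite -ltcR -eE.
have Vc : cauchy (F : set_system V).
  apply/cauchy_ballP => e /realE[r r0 ->].
  by apply: filterS (Fc r r0) => -[x y] /= /ballE.
have /cvg_ex[l Fl] : cvg (F : set_system V) by exact: cauchy_cvg Vc.
apply/cvg_ex; exists (l : realmod V); apply/cvg_ballP => e e0.
have e0' : 0 < e%:C by rewrite ltcR.
move/cvg_ballP: Fl => /(_ _ e0'); apply: filterS => x; exact: (ballE e l x).2.
Qed.

HB.instance Definition _ := Uniform_isComplete.Build (realmod V) realmod_complete.

End Completeness.

End RestrictScalars.

Section Bounded.
Context (R : realType) (A : cstarAlgType R) (H : hilbertModType A).
Implicit Types (S T : adjop H) (x y : H).

Definition opbound (c : R) T := forall x, rnorm (T x) <= c * rnorm x.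

Lemma opboundW c d T : c <= d -> opbound c T -> opbound d T.
Proof. by move=> cd Tc x; rewrite (le_trans (Tc x)) ?ler_wpM2r ?rnorm_ge0. Qed.

(** The functionals [hinner (T x)], for [x] in the unit ball, are pointwise
    bounded because [hinner (T x) y = hinner x (adj T y)]; by Banach-Steinhaus
    they are uniformly bounded, and evaluating at [T x] itself bounds [T]. *)
Lemma adjop_bounded T : exists2 c : R, 0 < c & opbound c T.
Proof.
pose F : set (realmod H -> realmod A) :=
  [set f | exists2 x : H, rnorm x <= 1 & f = (fun y : H => hinner (T x) y)].
have F_lin f : F f -> bounded_fun_norm f /\ linear f.
  move=> [x _ ->]; split=> [r|k y z]; last first.
    exact: etrans (hinnerDr _ _ _) (congr1 (+%R^~ _) (hinnerZr _ _ _)).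
  exists (4 * rnorm (T x) * r) => y yr.
  by apply: le_trans (rnorm_inner_le _ _) _; rewrite ler_wpM2l ?mulr_ge0 ?rnorm_ge0.
have F_ptw : pointwise_bounded F.
  move=> y; exists (4 * rnorm (adj T y)) => f [x x1 ->].
  apply: le_trans (_ : rnorm (hinner (T x) y) <= _) _ => //.
  rewrite adjE; apply: le_trans (rnorm_inner_le _ _) _.
  by rewrite ler_wpM2r ?rnorm_ge0 // ler_piMr.
have [M MF] := Banach_Steinhauss F_lin F_ptw 1.
have TM x : rnorm x <= 1 -> rnorm (T x) <= M.
  move=> x1; have [/eqP Tx0|Tx0] := eqVneq (rnorm (T x)) 0.
    have := MF _ (ex_intro2 _ _ x x1 erefl) 0; rewrite normr0 => /(_ ler01).
    by move/eqP: Tx0 => ->; exact: le_trans.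
  have Tx_gt0 : 0 < rnorm (T x) by rewrite lt_def Tx0 rnorm_ge0.
  pose y : H := (rnorm (T x))^-1%:C *: T x.
  have y1 : rnorm y <= 1.
    by rewrite /y rnormZ ger0_norm ?invr_ge0 ?rnorm_ge0 // mulVf.
  have := MF _ (ex_intro2 _ _ x x1 erefl) y y1.
  suff -> : `|(hinner (T x) y : realmod A)| = rnorm (T x) by [].
  change (rnorm (hinner (T x) y) = rnorm (T x)).
  rewrite /y hinnerZr rnormZ rnorm_inner ger0_norm ?invr_ge0 ?rnorm_ge0 //.
  by rewrite expr2 mulKf.
exists (Num.max M 1); first by rewrite lt_max ltr01 orbT.
move=> x; have [/eqP/eqP/rnorm_eq0 ->|x0] := eqVneq (rnorm x) 0.
  by rewrite adjop0 !rnorm0 mulr0.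
have x_gt0 : 0 < rnorm x by rewrite lt_def x0 rnorm_ge0.
have := TM ((rnorm x)^-1%:C *: x).
rewrite adjopZ !rnormZ ger0_norm ?invr_ge0 ?rnorm_ge0 // mulVf // lexx => /(_ isT).
rewrite mulrC ler_pdivrMr // => /le_trans; apply.
by rewrite ler_pM2r // le_max lexx.
Qed.

Lemma opboundD c d S T : opbound c S -> opbound d T -> opbound (c + d) (S + T).
Proof.
move=> Sc Td x; rewrite mulrDl.
by apply: le_trans (rnormD _ _) _; exact: lerD (Sc x) (Td x).
Qed.

Lemma opboundM c d S T :
  0 <= c -> opbound c S -> opbound d T -> opbound (c * d) (S * T).
Proof.
move=> c0 Sc Td x; rewrite -mulrA (le_trans (Sc _)) // ler_wpM2l //; exact: Td.
Qed.

Lemma opboundZ c (k : R) T : opbound c T -> opbound (`|k| * c) (k%:C *: T).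
Proof. by move=> Tc x; rewrite rnormZ -mulrA ler_wpM2l //; exact: Tc. Qed.

Lemma opboundN c T : opbound c T -> opbound c (- T).
Proof. by move=> Tc x; rewrite rnormN; exact: Tc. Qed.

Lemma opbound0 : opbound 0 (0 : adjop H).
Proof. by move=> x; rewrite rnorm0 mul0r. Qed.

Lemma opbound1 : opbound 1 (1 : adjop H).
Proof. by move=> x; rewrite mul1r. Qed.

Lemma opboundX c T n : 0 <= c -> opbound c T -> opbound (c ^+ n) (T ^+ n).
Proof.
move=> c0 Tc; elim: n => [|n IHn]; first exact: opbound1.
by rewrite !exprS; exact: opboundM.
Qed.

Lemma cvg_adjop T (u : nat -> H) l : u @ \oo --> l -> T (u n) @[n --> \oo] --> T l.
Proof.
have [c c0 Tc] := adjop_bounded T => /cvg_rnormP ul; apply/cvg_rnormP => e e0.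
have [|N uN] := ul (e / c); first by rewrite divr_gt0.
exists N => n /uN; rewrite -adjopB ltr_pdivlMr // mulrC.
exact: le_lt_trans (Tc _).
Qed.

Lemma cvg_hinnerl (u : nat -> H) l y :
  u @ \oo --> l -> hinner (u n) y @[n --> \oo] --> hinner l y.
Proof.
move=> /cvg_rnormP ul; apply/cvg_rnormP => e e0.
have y0 : 0 < 4 * rnorm y + 1 by rewrite ltr_wpDl // mulr_ge0 ?rnorm_ge0.
have [|N uN] := ul (e / (4 * rnorm y + 1)); first by rewrite divr_gt0.
exists N => n /uN; rewrite -hinnerNl -hinnerDl ltr_pdivlMr //.
apply: le_lt_trans; apply: le_trans (rnorm_inner_le _ _) _.
have := rnorm_ge0 (u n - l); have := rnorm_ge0 y.
lra.
Qed.

Lemma cvg_hinnerr (u : nat -> H) l y :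
  u @ \oo --> l -> hinner y (u n) @[n --> \oo] --> hinner y l.
Proof.
move=> /cvg_rnormP ul; apply/cvg_rnormP => e e0.
have y0 : 0 < 4 * rnorm y + 1 by rewrite ltr_wpDl // mulr_ge0 ?rnorm_ge0.
have [|N uN] := ul (e / (4 * rnorm y + 1)); first by rewrite divr_gt0.
exists N => n /uN; rewrite -hinnerNr -hinnerDr ltr_pdivlMr //.
apply: le_lt_trans; apply: le_trans (rnorm_inner_le _ _) _.
have := rnorm_ge0 (u n - l); have := rnorm_ge0 y.
lra.
Qed.

(** Strong limits of a sequence and of its adjoints are adjoint to each other by
    continuity of the inner product. *)
Lemma adjop_limit (V : nat -> adjop H) :
  (forall x, exists l : H, V n x @[n --> \oo] --> l) ->
  (forall x, exists l : H, adj (V n) x @[n --> \oo] --> l) ->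
  exists T : adjop H, (forall x, V n x @[n --> \oo] --> T x) /\
                      (forall x, adj (V n) x @[n --> \oo] --> adj T x).
Proof.
move=> /choice[f Vf] /choice[g Vg].
have fg : is_adjoint f g.
  move=> x y; apply: cvg_unique (cvg_hinnerl (y := y) (Vf x)) _ => //.
  have -> : (fun n => hinner (V n x) y) = (fun n => hinner x (adj (V n) y)).
    by apply/funext => n; rewrite adjE.
  exact: cvg_hinnerr.
have fP : f \in @adjointable R A H by apply/asboolP; exists g.
exists (AdjOp fP); split=> // x.
suff <- : g x = adj (AdjOp fP) x by exact: Vg.
by apply: hinner_inj => z; rewrite -adjE -fg.
Qed.

End Bounded.

(** * Power series in a self-adjoint operator *)

Section PowerSeries.
Context (R : realType) (A : cstarAlgType R) (H : hilbertModType A).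
Implicit Types (S T U W y Z : adjop H) (x : H) (a b r K L : R).

(** Polynomials in [y] with nonnegative real coefficients, recorded together with
    the sum [a] of the coefficients.  This sum is the value of the polynomial at
    1, so that scalar estimates at 1 control the operator [T]. *)
Inductive power_comb y : R -> adjop H -> Prop :=
| comb0 : power_comb y 0 0
| combS a T r n : power_comb y a T -> 0 <= r ->
    power_comb y (a + r) (T + r%:C *: y ^+ n).

Lemma combXn y n : power_comb y 1 (y ^+ n).
Proof.
by have := combS n (comb0 y) ler01; rewrite !add0r scale1r.
Qed.

Lemma comb_ge0 y a T : power_comb y a T -> 0 <= a.
Proof. by elim=> // *; rewrite addr_ge0. Qed.

Lemma combD y a b S T :
  power_comb y a S -> power_comb y b T -> power_comb y (a + b) (S + T).
Proof.
move=> Sa; elim=> [|{}b {}T r n _ IH r0]; first by rewrite !addr0.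
by rewrite !addrA; exact: combS.
Qed.

Lemma combZXn y a T r n :
  0 <= r -> power_comb y a T -> power_comb y (r * a) ((r%:C *: y ^+ n) * T).
Proof.
move=> r0; elim=> [|{}a {}T s m _ IH s0]; first by rewrite !mulr0; exact: comb0.
have -> : (r%:C *: y ^+ n) * (T + s%:C *: y ^+ m) =
    (r%:C *: y ^+ n) * T + (r * s)%:C *: y ^+ (n + m).
  rewrite mulrDr -adjop_scalerAr -[_ * y ^+ m]adjop_scalerAl scalerA -exprD.
  by rewrite -rmorphM [s * r]mulrC.
by rewrite mulrDr; apply: combS => //; rewrite mulr_ge0.
Qed.

Lemma combM y a b S T :
  power_comb y a S -> power_comb y b T -> power_comb y (a * b) (S * T).
Proof.
move=> + Tb; elim=> [|{}a {}S r n _ IH r0]; first by rewrite !mul0r; exact: comb0.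
by rewrite !mulrDl; apply: combD IH _; exact: combZXn.
Qed.

Lemma combZ y a T r :
  0 <= r -> power_comb y a T -> power_comb y (r * a) (r%:C *: T).
Proof.
by move=> r0 /(combZXn 0 r0); rewrite expr0 -adjop_scalerAl mul1r.
Qed.

Lemma comb_comm y Z a T : Z * y = y * Z -> power_comb y a T -> Z * T = T * Z.
Proof.
move=> Zy; have Zyn n : Z * y ^+ n = y ^+ n * Z by exact: commrX.
elim=> [|{}a {}T r n _ IH _]; first by rewrite mulr0 mul0r.
by rewrite mulrDr mulrDl IH -adjop_scalerAr Zyn adjop_scalerAl.
Qed.

Lemma adjX T n : adj (T ^+ n) = adj T ^+ n.
Proof.
by elim: n => [|n IHn]; [by rewrite !expr0 adj1 | rewrite exprSr adjM IHn -exprS].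
Qed.

Lemma comb_adj y a T : adj y = y -> power_comb y a T -> adj T = T.
Proof.
move=> yy; elim=> [|{}a {}T r n _ IH _]; first exact: adj0.
by rewrite adjD adjZr adjX yy IH.
Qed.

Lemma comb_bound y K a T :
  (forall n, opbound K (y ^+ n)) -> power_comb y a T -> opbound (K * a) T.
Proof.
move=> yK; elim=> [|{}a {}T r n _ IH r0]; first by rewrite mulr0; exact: opbound0.
rewrite mulrDr; apply: opboundD => //.
by rewrite mulrC -{1}(ger0_norm r0); exact: opboundZ.
Qed.

(** Nonnegative increments turn the boundedness of the scalar sequence [a] into
    the Cauchy property of the operator sequence [S], because the difference of
    two terms of [S] is again a nonnegative combination of powers of [y]. *)
Lemma comb_limit y K L (a : nat -> R) (S : nat -> adjop H) :
  0 <= K -> adj y = y -> (forall n, opbound K (y ^+ n)) ->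
  power_comb y (a 0%N) (S 0%N) ->
  (forall n, power_comb y (a n.+1 - a n) (S n.+1 - S n)) ->
  (forall n, a n <= L) ->
  exists T, [/\ adj T = T, forall x, S n x @[n --> \oo] --> T x,
    opbound (K * L) T & forall Z, Z * y = y * Z -> Z * T = T * Z].
Proof.
move=> K0 yy yK S0 SS aL.
have Sd m d : power_comb y (a (m + d)%N - a m) (S (m + d)%N - S m).
  elim: d => [|d IHd]; first by rewrite addn0 !subrr; exact: comb0.
  have telescope (V : zmodType) (u v w : V) : v - u + (w - v) = w - u by zmod.
  by have := combD IHd (SS (m + d)%N); rewrite addnS !telescope.
have Sn n : power_comb y (a n) (S n).
  by have := combD S0 (Sd 0%N n); rewrite add0n [a 0%N + _]addrC [S 0%N + _]addrC !subrK.
have Sadj n : adj (S n) = S n by exact: comb_adj (Sn n).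
have a_sup : has_sup (range a) by split; [exists (a 0%N), 0%N|exists L => _ [n _ <-]].
have Sc x : exists l : H, S n x @[n --> \oo] --> l.
  apply: rnorm_complete => e e0.
  have Kx : 0 < K * rnorm x + 1 by rewrite ltr_wpDl // mulr_ge0 ?rnorm_ge0.
  have [|_ [N _ <-] aN] := @sup_adherent _ (range a) (e / (K * rnorm x + 1)) _ a_sup.
    by rewrite divr_gt0.
  exists N => n Nn; rewrite -adjopBE.
  have an : a n <= sup (range a) by apply: sup_upper_bound => //; exists n.
  have {aN} : a n - a N < e / (K * rnorm x + 1) by lra.
  have := Sd N (n - N)%N; rewrite subnKC // => Snn.
  have := comb_bound yK Snn x; have := comb_ge0 Snn; have := rnorm_ge0 x.
  rewrite ltr_pdivlMr //; set d := a n - a N.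
  move=> x0 d0 Sx dK; apply: le_lt_trans Sx _; nra.
have [|T [ST _]] := adjop_limit Sc; first move=> x.
  by rewrite (_ : (fun n => _) = (fun n => S n x)) //; apply/funext => n; rewrite Sadj.
exists T; split=> //.
- apply: adj_unique => x z; apply: cvg_unique (cvg_hinnerl (y := z) (ST x)) _ => //.
  have -> : (fun n => hinner (S n x) z) = (fun n => hinner x (S n z)).
    by apply/funext => n; rewrite adjE Sadj.
  exact: cvg_hinnerr.
- move=> x; apply/ler_addgt0Pr => e e0.
  have /cvg_rnormP /(_ _ e0)[N /(_ N (leqnn _))] := ST x.
  have := comb_bound yK (Sn N) x; have := rnormB (S N x) (S N x - T x).
  rewrite opprB addrCA subrr addr0.
  have : K * a N * rnorm x <= K * L * rnorm x.
    by rewrite ler_wpM2r ?rnorm_ge0 // ler_wpM2l.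
  lra.
- move=> Z Zy; apply: adjopP => x /=.
  apply: cvg_unique (cvg_adjop (T := Z) (ST x)) _ => //.
  have -> : (fun n => Z (S n x)) = (fun n => S n (Z x)).
    by apply/funext => n; rewrite -!adjopME (comb_comm Zy (Sn n)).
  exact: ST.
Qed.

(** Products of strongly convergent sequences converge strongly when the left
    factor is uniformly bounded. *)
Lemma cvg_opbound (c : R) (V : nat -> adjop H) (u : nat -> H) (l m : H) :
  0 <= c -> (forall n, opbound c (V n)) ->
  u @ \oo --> l -> V n l @[n --> \oo] --> m -> V n (u n) @[n --> \oo] --> m.
Proof.
move=> c0 Vc /cvg_rnormP ul /cvg_rnormP Vl; apply/cvg_rnormP => e e0.
have [|N uN] := ul (e / 2 / (c + 1)); first by rewrite !divr_gt0 // ltr_wpDl.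
have [|M VM] := Vl (e / 2); first by rewrite divr_gt0.
exists (maxn N M) => n; rewrite geq_max => /andP[/uN Nn /VM Mn].
rewrite -(subrK (V n l) (V n (u n))) -addrA.
apply: le_lt_trans (rnormD _ _) _; rewrite -adjopB.
have := Vc n (u n - l); move: Nn; rewrite ltr_pdivlMr ?ltr_wpDl //.
have := rnorm_ge0 (u n - l); lra.
Qed.

End PowerSeries.

Section FunctionalCalculus.
Context (R : realType) (A : cstarAlgType R) (H : hilbertModType A).
Implicit Types (S T U W X Y y Z : adjop H) (x : H) (a b c e r K L : R).

(** The root is [1 - w], where [w] is the fixed point of [w = (y + w * w) / 2]
    reached by iterating from 0; its scalar shadow at [y = 1] increases and stays
    below 1.  Only the powers of [y] have to be bounded: [K] replaces the norm
    condition, which makes the spectral radius of [y] the relevant quantity. *)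
Lemma sqrt_one_sub y K :
  0 <= K -> adj y = y -> (forall n, opbound K (y ^+ n)) ->
  exists s, [/\ s * s = 1 - y, adj s = s, opbound K (1 - s) &
                forall Z, Z * y = y * Z -> Z * s = s * Z].
Proof.
move=> K0 yy yK.
pose w n : adjop H := iter n (fun w => (2^-1)%:C *: (y + w * w)) 0.
pose a n : R := iter n (fun a => 2^-1 * (1 + a * a)) 0.
have y1 : power_comb y 1 y by have := combXn y 1; rewrite expr1.
have half_ge0 : 0 <= 2^-1 :> R by rewrite invr_ge0.
have wC n : power_comb y (a n) (w n).
  elim: n => [|n IHn]; first exact: comb0.
  by apply: combZ => //; apply: combD => //; exact: combM.
have ww m n : w m * w n = w n * w m.
  apply: comb_comm (wC n); apply/esym; apply: comb_comm (wC m); exact: erefl.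
have wS n : power_comb y (a n.+1 - a n) (w n.+1 - w n).
  elim: n => [|n IHn]; first by rewrite !subr0; exact: (wC 1%N).
  have -> : a n.+2 - a n.+1 = 2^-1 * ((a n.+1 - a n) * (a n.+1 + a n)).
    rewrite [LHS](_ : _ = 2^-1 * (1 + a n.+1 * a n.+1) - 2^-1 * (1 + a n * a n)) //.
    by ring.
  have -> : w n.+2 - w n.+1 = (2^-1)%:C *: ((w n.+1 - w n) * (w n.+1 + w n)).
    rewrite [LHS](_ : _ = (2^-1)%:C *: (y + w n.+1 * w n.+1)
                          - (2^-1)%:C *: (y + w n * w n)) //.
    rewrite -scalerBr; congr (_ *: _).
    by rewrite mulrDr !mulrBl (ww n.+1 n); zmod.
  by apply: combZ => //; apply: combM => //; exact: combD.
have a1 n : a n <= 1.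
  elim: n => [|n IHn]; first exact: ler01.
  have -> : a n.+1 = 2^-1 * (1 + a n * a n) by [].
  by have := comb_ge0 (wC n); nra.
have [T [TT wT TK TC]] := comb_limit K0 yy yK (wC 0%N) wS a1.
have TE : y + T * T = T + T.
  apply: adjopP => x; rewrite !adjopDE adjopME.
  have wK n : opbound K (w n).
    by apply: opboundW (comb_bound yK (wC n)); rewrite ler_piMr.
  have wwT := cvg_opbound K0 wK (wT x) (wT (T x)).
  have wST : w n.+1 x @[n --> \oo] --> T x by rewrite (cvg_shiftS (w^~ x)).
  have wE n : w n.+1 x + w n.+1 x = y x + w n (w n x).
    rewrite -[w n.+1 x]/((2^-1)%:C *: (y x + w n (w n x))) -scalerDl -rmorphD /=.
    by rewrite (_ : 2^-1 + 2^-1 = 1 :> R) ?scale1r //; lra.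
  have := seq_cvgD wST wST; under eq_fun do rewrite wE.
  have yx : y x @[n --> \oo] --> y x by exact: cvg_cst.
  by move=> wT2; exact: seq_cvg_unique (seq_cvgD yx wwT) wT2.
exists (1 - T); split.
- rewrite mulrBr !mulrBl !mul1r !mulr1.
  have -> : y = T + T - T * T by rewrite -TE addrK.
  by zmod.
- by rewrite adjB adj1 TT.
- by rewrite subKr -[K]mulr1.
- by move=> Z /TC ZT; rewrite mulrBr mulrBl mulr1 mul1r ZT.
Qed.

(** The Neumann series, obtained as the fixed point of [w = 1 + q y w]. *)
Lemma neumann y q :
  0 <= q < 1 -> adj y = y -> opbound 1 y ->
  exists s, [/\ s * (1 - q%:C *: y) = 1, adj s = s, opbound (1 - q)^-1 s &
                forall Z, Z * y = y * Z -> Z * s = s * Z].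
Proof.
move=> /andP[q0 q1] yy yb.
have yK n : opbound 1 (y ^+ n) by rewrite -(expr1n _ n); exact: opboundX.
pose w n : adjop H := iter n (fun w => 1 + (q%:C *: y) * w) 0.
pose a n : R := iter n (fun a => 1 + q * a) 0.
have qy : power_comb y q (q%:C *: y).
  by have := combZ q0 (combXn y 1); rewrite mulr1 expr1.
have one : power_comb y 1 1 by exact: (combXn y 0).
have wS n : power_comb y (a n.+1 - a n) (w n.+1 - w n).
  elim: n => [|n IHn].
    by rewrite /a /w /= !mulr0 !addr0 !subr0.
  have -> : a n.+2 - a n.+1 = q * (a n.+1 - a n).
    by rewrite [LHS](_ : _ = (1 + q * a n.+1) - (1 + q * a n)) //; ring.
  have -> : w n.+2 - w n.+1 = (q%:C *: y) * (w n.+1 - w n).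
    rewrite [LHS](_ : _ = (1 + (q%:C *: y) * w n.+1) - (1 + (q%:C *: y) * w n)) //.
    by rewrite mulrBr; zmod.
  exact: combM.
have q1' : 0 < 1 - q by rewrite subr_gt0.
have aL n : a n <= (1 - q)^-1.
  elim: n => [|n IHn]; first by rewrite invr_ge0 ltW.
  have -> : a n.+1 = 1 + q * a n by [].
  have : (1 - q)^-1 * (1 - q) = 1 by rewrite mulVf // gt_eqF.
  by move: IHn; set u := (1 - q)^-1; nra.
have [T [TT wT Tb TC]] := comb_limit ler01 yy yK (comb0 y) wS aL.
have TE : T = 1 + (q%:C *: y) * T.
  apply: adjopP => x.
  have wST : w n.+1 x @[n --> \oo] --> T x by rewrite (cvg_shiftS (w^~ x)).
  have x1 : x @[n --> \oo] --> x by exact: cvg_cst.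
  apply: seq_cvg_unique wST _.
  exact: seq_cvgD x1 (cvg_adjop (T := q%:C *: y) (wT x)).
have Ty : y * T = T * y by apply: TC.
exists T; split=> //; last by rewrite -[X in opbound X]mul1r.
by rewrite mulrBr mulr1 -adjop_scalerAr -Ty adjop_scalerAl {1}TE addrK.
Qed.

End FunctionalCalculus.

(** * Unitaries, contractions and positivity *)

Section Positivity.
Context (R : realType) (A : cstarAlgType R) (H : hilbertModType A).
Implicit Types (S T U V W X Y Z : adjop H) (x : H) (a b c d r t K : R).

Lemma adjop_expand_i Z Z' : adj Z = Z -> adj Z' = Z' -> Z * Z' = Z' * Z ->
  let V := Z + 'i *: Z' in
  [/\ adj V = Z - 'i *: Z', adj V * V = Z * Z + Z' * Z' &
      V * adj V = Z * Z + Z' * Z'].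
Proof.
move=> ZZ ZZ' ZC V.
have VE : adj V = Z - 'i *: Z' by rewrite adjD adjZ ZZ ZZ' conjCi scaleNr.
have ii : ('i *: Z') * ('i *: Z') = - (Z' * Z').
  by rewrite -adjop_scalerAl -adjop_scalerAr scalerA -expr2 sqrCi scaleN1r.
have iC : Z * ('i *: Z') = ('i *: Z') * Z.
  by rewrite -adjop_scalerAl -adjop_scalerAr ZC.
by split=> //; rewrite VE /V !(mulrDr, mulrDl, mulrN, mulNr) ii iC; zmod.
Qed.

Lemma isometry_bound U : adj U * U = 1 -> opbound 1 U.
Proof.
move=> UU x; rewrite mul1r -(ler_pXn2r (_ : 0 < 2)%N) ?nnegrE ?rnorm_ge0 //.
by rewrite -!rnorm_inner adjE -adjopME UU.
Qed.

Lemma adjMl_eq0 V : adj V * V = 0 -> V = 0.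
Proof.
by move=> VV; apply: adjopP => x; apply: hinner_eq0; rewrite adjE -adjopME VV hinner0r.
Qed.

(** [Z] and [Z'] are the real and imaginary parts of a [V] with [adj V * V = 0]. *)
Lemma sum_squares_eq0 Z Z' : adj Z = Z -> adj Z' = Z' -> Z * Z' = Z' * Z ->
  Z * Z + Z' * Z' = 0 -> Z = 0.
Proof.
move=> ZZ ZZ' ZC ZZ'0; have [VE VV _] := adjop_expand_i ZZ ZZ' ZC.
have V0 : Z + 'i *: Z' = 0 by apply: adjMl_eq0; rewrite VV.
have : (2 : R)%:C *: Z = 0.
  have -> : (2 : R)%:C *: Z = (Z + 'i *: Z') + adj (Z + 'i *: Z').
    by rewrite VE (rmorph_nat (real_complex R)) scaler_nat; zmod.
  by rewrite V0 adj0 addr0.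
move/(congr1 (fun T => (2^-1 : R)%:C *: T)).
by rewrite scalerA -rmorphM mulVf ?pnatr_eq0 // scale1r scaler0.
Qed.

(** A self-adjoint [Y] with bounded powers is the real part of the unitary
    [Y + i sqrt(1 - Y^2)], the operator form of [cos t = Re (exp (i t))]. *)
Lemma selfadj_unitary Y K :
  0 <= K -> adj Y = Y -> (forall n, opbound K (Y ^+ n)) ->
  exists U, [/\ opbound 1 U, opbound 1 (adj U), adj U * U = 1, U * adj U = 1 &
                Y + Y = U + adj U].
Proof.
move=> K0 YY YK.
have [|n|s [ss sa _ sC]] := @sqrt_one_sub _ _ _ (Y * Y) K K0.
- by rewrite adjM YY.
- by rewrite -expr2 -exprM; exact: YK.
have Ys : Y * s = s * Y by apply: sC; rewrite mulrA.
have [UE UU UU'] := adjop_expand_i YY sa Ys.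
exists (Y + 'i *: s).
have U1 : adj (Y + 'i *: s) * (Y + 'i *: s) = 1 by rewrite UU ss addrC subrK.
have U2 : (Y + 'i *: s) * adj (Y + 'i *: s) = 1 by rewrite UU' ss addrC subrK.
split=> //; [exact: isometry_bound|apply: isometry_bound; rewrite adjK //|].
by rewrite UE; zmod.
Qed.

Lemma opbound_half T c : opbound (c + c) (T + T) -> opbound c T.
Proof.
move=> Tc x; have := Tc x; rewrite adjopDE.
rewrite -mulr2n -scaler_nat -(rmorph_nat (real_complex R)) rnormZ normr_nat; lra.
Qed.

(** Unitaries are isometric, so a mean of two of them is a contraction.  This
    yields sharp norm bounds from crude ones: for self-adjoint operators the
    spectral radius bounds the norm. *)
Lemma selfadj_contraction Y K :
  0 <= K -> adj Y = Y -> (forall n, opbound K (Y ^+ n)) -> opbound 1 Y.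
Proof.
move=> K0 YY /(selfadj_unitary K0 YY)[U [U1 U1' _ _ YU]].
by apply: opbound_half; rewrite YU; exact: opboundD.
Qed.

(** With [Y] the real part of a unitary [U], the operator [1 - Y^2] equals
    [(2 - U^2 - adj U^2) / 4]; squares of self-adjoint operators are therefore
    positive. *)
Lemma opbound_one_sub_sqr Y : adj Y = Y -> opbound 1 Y -> opbound 1 (1 - Y * Y).
Proof.
move=> YY Y1.
have [|n|U [U1 U1' UU UU' YU]] := @selfadj_unitary Y 1 _ YY; first exact: ler01.
  by rewrite -(expr1n _ n); exact: opboundX.
(* Both sides are multiplied by 4 so that no scalars occur. *)
do 2! apply: opbound_half.
have -> : 1 - Y * Y + (1 - Y * Y) + (1 - Y * Y + (1 - Y * Y)) =
    (1 - U * U) + (1 - adj U * adj U).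
  have : (Y + Y) * (Y + Y) = (U + adj U) * (U + adj U) by rewrite YU.
  rewrite !mulrDl !mulrDr UU UU' => e.
  have -> : adj U * adj U = (Y * Y + Y * Y + (Y * Y + Y * Y)) - U * U - 1 - 1.
    by rewrite e; zmod.
  by zmod.
have sub_sqr V : opbound 1 V -> opbound (1 + 1) (1 - V * V).
  move=> V1; apply: opboundD; first exact: opbound1.
  by apply: opboundN; rewrite -[1]mulr1; exact: opboundM.
exact: opboundD (sub_sqr _ U1) (sub_sqr _ U1').
Qed.

Local Notation homothety t := (t%:C *: (1 : adjop H)).

(** Positivity of the spectrum, expressed by norms: a self-adjoint operator whose
    distance to some [t > 0] is at most [t].  In this form sums of positive
    operators are positive by the triangle inequality. *)
Definition nonneg Y := adj Y = Y /\ exists2 t : R, 0 < t & opbound t (homothety t - Y).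

Lemma nonneg_adj Y : nonneg Y -> adj Y = Y. Proof. by case. Qed.

Lemma nonnegD Y Z : nonneg Y -> nonneg Z -> nonneg (Y + Z).
Proof.
move=> [YY [t t0 Yt]] [ZZ [s s0 Zs]]; split; first by rewrite adjD YY ZZ.
exists (t + s); first by rewrite addr_gt0.
have -> : homothety (t + s) - (Y + Z) = (homothety t - Y) + (homothety s - Z).
  by rewrite rmorphD scalerDl; zmod.
exact: opboundD.
Qed.

Lemma nonnegZ Y r : 0 < r -> nonneg Y -> nonneg (r%:C *: Y).
Proof.
move=> r0 [YY [t t0 Yt]]; split; first by rewrite adjZr YY.
exists (r * t); first by rewrite mulr_gt0.
have -> : homothety (r * t) - r%:C *: Y = r%:C *: (homothety t - Y).
  by rewrite scalerBr scalerA -rmorphM.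
by rewrite -{1}(gtr0_norm r0); exact: opboundZ.
Qed.

Lemma nonneg_sqr X : adj X = X -> nonneg (X * X).
Proof.
move=> XX; split; first by rewrite adjM XX.
have [c c0 Xc] := adjop_bounded X; exists (c ^+ 2); first by rewrite exprn_gt0.
pose Y := (c^-1)%:C *: X.
have Y1 : opbound 1 Y.
  have := opboundZ (c^-1) Xc; rewrite ger0_norm ?invr_ge0 ?ltW //.
  by rewrite mulVf ?gt_eqF.
have YY : adj Y = Y by rewrite adjZr XX.
have := opboundZ (c ^+ 2) (opbound_one_sub_sqr YY Y1).
rewrite ger0_norm ?exprn_ge0 ?ltW // mulr1.
have -> : (c ^+ 2)%:C *: (1 - Y * Y) = homothety (c ^+ 2) - X * X; last by [].
rewrite scalerBr -adjop_scalerAl -adjop_scalerAr !scalerA -!rmorphM /=.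
by rewrite expr2 -mulrA mulVKf ?mulfV ?scale1r ?gt_eqF.
Qed.

(** [Y / t] has the form [1 - y] with [y] a self-adjoint contraction. *)
Lemma nonneg_sqrt Y : nonneg Y ->
  exists X, [/\ nonneg X, X * X = Y & forall Z, Z * Y = Y * Z -> Z * X = X * Z].
Proof.
move=> [YY [t t0 Yt]].
pose y := (t^-1)%:C *: (homothety t - Y).
have y1 : opbound 1 y.
  have := opboundZ (t^-1) Yt; rewrite ger0_norm ?invr_ge0 ?ltW //.
  by rewrite mulVf ?gt_eqF.
have yy : adj y = y by rewrite adjZr adjB adjZr adj1 YY.
have yn n : opbound 1 (y ^+ n) by rewrite -(expr1n _ n); exact: opboundX.
have tV : t^-1 * t = 1 by rewrite mulVf ?gt_eqF.
have yE : 1 - y = (t^-1)%:C *: Y.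
  by rewrite /y scalerBr scalerA -rmorphM tV scale1r subKr.
have [s [ss sa s1 sC]] := sqrt_one_sub ler01 yy yn.
have s_ge0 : nonneg s by split=> //; exists 1 => //; rewrite scale1r.
have sqrt_gt0 : 0 < Num.sqrt t by rewrite sqrtr_gt0.
exists ((Num.sqrt t)%:C *: s); split; first exact: nonnegZ.
  rewrite -adjop_scalerAl -adjop_scalerAr scalerA -rmorphM -expr2.
  by rewrite sqr_sqrtr ?ltW // ss yE scalerA -rmorphM mulrC tV scale1r.
move=> Z ZY; rewrite -adjop_scalerAl -adjop_scalerAr sC //.
rewrite /y -adjop_scalerAl -adjop_scalerAr mulrBr mulrBl.
by rewrite -adjop_scalerAl -adjop_scalerAr mulr1 mul1r ZY.
Qed.

End Positivity.

(** * Positivity of [adj T * T], resolvents and dense ranges *)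

Section PositiveSquares.
Context (R : realType) (A : cstarAlgType R) (H : hilbertModType A).
Implicit Types (S T U V W X Y Z : adjop H) (x : H) (a b c d r t K : R).

Local Notation homothety t := (t%:C *: (1 : adjop H)).

Lemma opbound_le_lim T c : (forall d, 0 < d -> opbound (c + d) T) -> opbound c T.
Proof.
move=> Tcd x; apply/ler_addgt0Pr => e e0.
have x1 : 0 < rnorm x + 1 by rewrite ltr_wpDl ?rnorm_ge0.
have ex : 0 < e / (rnorm x + 1) by rewrite divr_gt0.
apply: le_trans (Tcd _ ex x) _; rewrite mulrDl lerD2l -mulrA ler_piMr ?(ltW e0) //.
by rewrite mulrC ler_pdivrMr // mul1r lerDl.
Qed.

(** [W * adj W] and [adj W * W] have the same nonzero spectrum.  Quantitatively,
    [(1 - adj W * W)^n = 1 - adj W * G * W], where [G] is the sum of the first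
    [n] powers of the contraction [1 - W * adj W].  So the powers of
    [1 - adj W * W] grow at most linearly; after division by [1 + e] they are
    bounded, and [selfadj_contraction] applies. *)
Lemma one_sub_swap_bound W : opbound 1 (1 - W * adj W) -> opbound 1 (1 - adj W * W).
Proof.
move=> WW1; have [c c0 Wc] := adjop_bounded W; have [d d0 Wd] := adjop_bounded (adj W).
set Y := adj W * W; set V := W * adj W in WW1.
have geom n : exists2 G : adjop H, opbound n%:R G &
    (1 - Y) ^+ n = 1 - adj W * G * W.
  elim: n => [|n [G Gn YG]].
    by exists 0; [exact: opbound0 | rewrite mulr0 mul0r subr0].
  exists (1 + G * (1 - V)).
    rewrite -natr1 addrC; apply: opboundD; first exact: opbound1.
    by rewrite -[n%:R]mulr1; exact: opboundM.
  rewrite exprSr YG /Y /V !(mulrDr, mulrDl, mulrN, mulNr, mulr1, mul1r, opprD, opprK).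
  by rewrite !mulrA; zmod.
have YY : adj (1 - Y) = 1 - Y by rewrite adjB adj1 adjM adjK.
apply: opbound_le_lim => e e0.
have e1 : 0 < 1 + e by rewrite addr_gt0.
pose Z := ((1 + e)^-1)%:C *: (1 - Y).
suff Z1 : opbound 1 Z.
  have -> : 1 - Y = (1 + e)%:C *: Z.
    by rewrite /Z scalerA -rmorphM mulfV ?gt_eqF // scale1r.
  by have := opboundZ (1 + e) Z1; rewrite gtr0_norm // mulr1.
(* [d * c / e] absorbs the linear growth: by Bernoulli,
   [1 + n d c <= (1 + d c / e) (1 + n e)]. *)
pose K := 1 + d * c / e.
have K0 : 0 <= K by rewrite addr_ge0 // divr_ge0 ?mulr_ge0 // ltW.
have ZZ : adj Z = Z by rewrite adjZr YY.
apply: (selfadj_contraction K0 ZZ) => n.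
have -> : Z ^+ n = ((1 + e)^-1 ^+ n)%:C *: (1 - Y) ^+ n.
  elim: n => [|n IHn]; first by rewrite !expr0 scale1r.
  rewrite exprS IHn /Z -adjop_scalerAl -adjop_scalerAr scalerA -rmorphM.
  by rewrite -!exprS.
have [G Gn ->] := geom n.
have GW : opbound (1 + d * n%:R * c) (1 - adj W * G * W).
  apply: opboundD; first exact: opbound1.
  apply: opboundN; apply: opboundM => //; first by rewrite mulr_ge0 // ltW.
  by apply: opboundM => //; rewrite ltW.
have := opboundZ ((1 + e)^-1 ^+ n) GW.
rewrite ger0_norm ?exprn_ge0 ?invr_ge0 ?ltW //; apply: opboundW.
rewrite exprVn mulrC ler_pdivrMr ?exprn_gt0 //.
have bern : 1 + n%:R * e <= (1 + e) ^+ n.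
  elim: n {G Gn GW} => [|n IHn]; first by rewrite mul0r addr0.
  rewrite exprS -natr1; have : 0 <= n%:R * (e * e) by rewrite !mulr_ge0 ?(ltW e0).
  by nra.
apply: le_trans (_ : K * (1 + n%:R * e) <= _); last by rewrite ler_wpM2l.
have -> : K * (1 + n%:R * e) = 1 + d * n%:R * c + (n%:R * e + d * c / e).
  by rewrite /K; field; rewrite gt_eqF.
by rewrite lerDl addr_ge0 ?divr_ge0 ?mulr_ge0 ?(ltW e0) ?(ltW d0) ?(ltW c0).
Qed.

Lemma nonneg_swap W : nonneg (W * adj W) -> nonneg (adj W * W).
Proof.
move=> [_ [t t0 Wt]]; split; first by rewrite adjM adjK.
exists t => //; set s := Num.sqrt t.
have s0 : 0 < s by rewrite sqrtr_gt0.
have ss : s^-1 * s^-1 = t^-1 by rewrite -invfM -expr2 sqr_sqrtr ?ltW.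
pose V := (s^-1)%:C *: W.
have VE : adj V = (s^-1)%:C *: adj W by rewrite adjZr.
have tVV : t%:C *: (1 - V * adj V) = homothety t - W * adj W.
  rewrite VE /V scalerBr -adjop_scalerAl -adjop_scalerAr !scalerA -!rmorphM /=.
  by rewrite ss mulfV ?scale1r ?gt_eqF.
have tVV' : t%:C *: (1 - adj V * V) = homothety t - adj W * W.
  rewrite VE /V scalerBr -adjop_scalerAl -adjop_scalerAr !scalerA -!rmorphM /=.
  by rewrite ss mulfV ?scale1r ?gt_eqF.
have V1 : opbound 1 (1 - V * adj V).
  have := opboundZ t^-1 Wt; rewrite -tVV scalerA -rmorphM mulVf ?gt_eqF //.
  by rewrite scale1r gtr0_norm ?invr_gt0 // mulVf // gt_eqF.
have := opboundZ t (one_sub_swap_bound V1).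
by rewrite tVV' gtr0_norm // mulr1.
Qed.

(** The theorem of Kelley, Vaught and Kaplansky.  Let [C] be the square root of
    [Y^2], where [Y = adj T * T], so that [D = C - Y] is twice the negative part
    of [Y].  For [W = T * D], the operator [adj W * W = - C D^2] is minus the
    square of a self-adjoint [Z].  On the other hand [adj W * W + W * adj W] is
    always a sum of squares, so [W * adj W] is positive, and by [nonneg_swap] so
    is [adj W * W].  Hence [Z = 0], which forces [D = 0] and [Y = C]. *)
Lemma nonneg_adjM T : nonneg (adj T * T).
Proof.
set Y := adj T * T.
have YY : adj Y = Y by rewrite adjM adjK.
have [C [Cge0 CC CZ]] := nonneg_sqrt (nonneg_sqr YY).
have CY : Y * C = C * Y by apply: CZ; rewrite mulrA.
have [G [Gge0 GG GZ]] := nonneg_sqrt Cge0.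
pose D := C - Y.
have CA := nonneg_adj Cge0; have GA := nonneg_adj Gge0.
have DD : adj D = D by rewrite adjB CA YY.
have DC : D * C = C * D by rewrite mulrBl mulrBr CY.
have YD : Y * D = - (C * D) by rewrite /D !mulrBr CC CY opprB.
have GD : D * G = G * D by exact: GZ.
pose Z := G * D; have ZZ : adj Z = Z by rewrite adjM GA DD GD.
pose W := T * D.
have WW : adj W * W = - (Z * Z).
  rewrite adjM DD -mulrA [adj T * _]mulrA -/Y YD /Z mulrN -GG.
  by rewrite !mulrA GD -!mulrA [G * (D * _)]mulrA -GD -!mulrA.
have WW' : nonneg (W * adj W).
  (* [P] and [Q] are twice the real part and minus twice the imaginary part. *)
  pose P := W + adj W; pose Q := 'i *: (W - adj W).
  have PP : adj P = P by rewrite adjD adjK addrC.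
  have QQ : adj Q = Q by rewrite adjZ adjB adjK conjCi scaleNr -scalerN opprB.
  have -> : W * adj W = (2^-1 : R)%:C *: (P * P + Q * Q) + Z * Z.
    have QE : Q * Q = - ((W - adj W) * (W - adj W)).
      by rewrite -adjop_scalerAl -adjop_scalerAr scalerA -expr2 sqrCi scaleN1r.
    have -> : P * P + Q * Q = (2 : R)%:C *: (W * adj W + adj W * W).
      rewrite QE (rmorph_nat (real_complex R)) scaler_nat /P.
      by rewrite !(mulrDl, mulrDr, mulrN, mulNr); zmod.
    by rewrite scalerA -rmorphM mulVf ?pnatr_eq0 // scale1r WW addrNK.
  apply: nonnegD; last exact: nonneg_sqr.
  by apply: nonnegZ; [rewrite invr_gt0|apply: nonnegD; exact: nonneg_sqr].
have [Z' [Z'ge0 ZZ' Z'C]] := nonneg_sqrt (nonneg_swap WW').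
have Z0 : Z = 0.
  apply: (sum_squares_eq0 ZZ (nonneg_adj Z'ge0)); last by rewrite ZZ' WW subrr.
  by apply: Z'C; rewrite WW mulrN mulNr mulrA.
have CD0 : C * D = 0 by rewrite -GG -mulrA -/Z Z0 mulr0.
have D0 : D = 0.
  by apply: adjMl_eq0; rewrite DD {1}/D mulrBl YD CD0 oppr0 subr0.
by rewrite -[Y](subKr C) -/D D0 subr0.
Qed.

Lemma resolvent Y e : nonneg Y -> 0 < e ->
  exists S, [/\ S * (Y + homothety e) = 1, adj S = S, opbound e^-1 S &
                forall Z, Z * Y = Y * Z -> Z * S = S * Z].
Proof.
move=> [YY [t t0 Yt]] e0; have te : 0 < t + e by rewrite addr_gt0.
pose y := (t^-1)%:C *: (homothety t - Y); pose q := t / (t + e).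
have q01 : 0 <= q < 1.
  by rewrite divr_ge0 ?ltW //= ltr_pdivrMr // mul1r ltrDl.
have y1 : opbound 1 y.
  have := opboundZ (t^-1) Yt; rewrite ger0_norm ?invr_ge0 ?ltW //.
  by rewrite mulVf ?gt_eqF.
have yy : adj y = y by rewrite adjZr adjB adjZr adj1 YY.
have [s [sy sa sb sC]] := neumann q01 yy y1.
exists (((t + e)^-1)%:C *: s); split.
- rewrite -adjop_scalerAl adjop_scalerAr; rewrite -[RHS]sy; congr (_ * _).
  rewrite /y /q scalerA -rmorphM /=.
  have -> : t / (t + e) / t = (t + e)^-1 by field; rewrite !gt_eqF.
  have one : 1 = ((t + e)^-1)%:C *: homothety (t + e).
    by rewrite scalerA -rmorphM mulVf ?gt_eqF // scale1r.
  by rewrite [X in _ = X - _]one -scalerBr rmorphD /= scalerDl; congr (_ *: _); zmod.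
- by rewrite adjZr sa.
- have := opboundZ ((t + e)^-1) sb; rewrite gtr0_norm ?invr_gt0 //.
  have -> : (t + e)^-1 * (1 - q)^-1 = e^-1; last by [].
  have -> : 1 - q = e / (t + e) by rewrite /q; field; rewrite gt_eqF.
  by field; rewrite !gt_eqF.
- move=> Z ZY; rewrite -adjop_scalerAl -adjop_scalerAr sC //.
  rewrite /y -adjop_scalerAl -adjop_scalerAr mulrBr mulrBl.
  by rewrite -adjop_scalerAl -adjop_scalerAr mulr1 mul1r ZY.
Qed.

(** With [S] the inverse of [adj T * T + e], the vector [z = S x] leaves the error
    [e T S x]; its square is [e * <x, (e S) (adj T * T S) x>], and both factors in
    parentheses are bounded independently of [e]. *)
Lemma range_adjM_dense T x d : 0 < d ->
  exists z, rnorm (T x - T (adj T (T z))) < d.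
Proof.
move=> d0.
(* The squared error is at most [8 * rnorm x ^+ 2 * e], where 8 is the constant 4
   of [rnorm_inner_le] times the bound 2 for [1 - e S]. *)
pose e := d ^+ 2 / (8 * rnorm x ^+ 2 + 1).
have den : 0 < 8 * rnorm x ^+ 2 + 1.
  by rewrite ltr_wpDl // mulr_ge0 ?exprn_ge0 ?rnorm_ge0.
have e0 : 0 < e by rewrite divr_gt0 // exprn_gt0.
have ed : (8 * rnorm x ^+ 2 + 1) * e = d ^+ 2 by rewrite /e mulrC divfK // gt_eqF.
clearbody e; have [S [SY SS Sb SC]] := resolvent (nonneg_adjM T) e0.
set Y := adj T * T in SY Sb SC.
have YS : Y * S = S * Y by apply: SC.
have eS : opbound 1 (e%:C *: S).
  by have := opboundZ e Sb; rewrite gtr0_norm // mulfV // gt_eqF.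
have YSE : Y * S = 1 - e%:C *: S.
  by rewrite YS -[X in X - _]SY mulrDr -adjop_scalerAr mulr1 addrK.
exists (S x).
have -> : T x - T (adj T (T (S x))) = (T * (e%:C *: S)) x.
  rewrite -(adjopME T S) -(adjopME _ (T * S)) -(adjopME T) -adjopBE.
  by congr (adjop_fun _ x); rewrite !mulrA -[_ * adj T * _]mulrA -[_ * Y * S]mulrA YSE
    mulrBr mulr1 subKr.
rewrite -(ltr_pXn2r (_ : 0 < 2)%N) ?nnegrE ?rnorm_ge0 ?(ltW d0) //.
rewrite -rnorm_inner adjE -[adj _ _]adjopME.
have -> : adj (T * (e%:C *: S)) * (T * (e%:C *: S)) =
    e%:C *: ((e%:C *: S) * (1 - e%:C *: S)).
  rewrite adjM adjZr SS -YSE mulrA -[_ * adj T * T]mulrA -/Y.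
  by rewrite -!mulrA -adjop_scalerAr -!adjop_scalerAr.
have B : opbound (1 * (1 + 1)) ((e%:C *: S) * (1 - e%:C *: S)).
  by apply: opboundM => //; apply: opboundD; [exact: opbound1|exact: opboundN].
apply: le_lt_trans (rnorm_inner_le _ _) _; rewrite rnormZ gtr0_norm //.
have Bx := B x; apply: le_lt_trans (_ : 8 * rnorm x ^+ 2 * e < _).
  have : rnorm x * e * rnorm (((e%:C *: S) * (1 - e%:C *: S)) x) <=
      rnorm x * e * (2 * rnorm x).
    rewrite ler_wpM2l ?mulr_ge0 ?rnorm_ge0 ?(ltW e0) //.
    by apply: le_trans Bx _; rewrite mul1r.
  lra.
lra.
Qed.

End PositiveSquares.

(** * Polar decomposition *)

Section Polar.
Context (R : realType) (A : cstarAlgType R) (H : hilbertModType A).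
Implicit Types (B E S T U V X Y Z : adjop H) (x y z u v : H) (c d e : R).

Local Notation homothety t := (t%:C *: (1 : adjop H)).

(** Continuity of [T], in the form used for invariance of closures. *)
Lemma closure_adjop (D D' : set H) T :
  (forall y, D y -> closure D' (T y)) -> forall z, closure D z -> closure D' (T z).
Proof.
move=> DD' z /closure_rnormP Dz; have [c c0 Tc] := adjop_bounded T.
apply/closure_rnormP => e e0.
have [|y /DD' /closure_rnormP D'y zy] := Dz (e / 2 / c); first by rewrite !divr_gt0.
have [|w D'w yw] := D'y (e / 2); first by rewrite divr_gt0.
exists w => //; rewrite -(subrKA (T y)); apply: le_lt_trans (rnormD _ _) _.
have := Tc (z - y); rewrite adjopB; move: zy; rewrite ltr_pdivlMr //.
lra.
Qed.

Lemma closure_ker (D : set H) T :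
  (forall y, D y -> T y = 0) -> forall z, closure D z -> T z = 0.
Proof.
move=> D0 z Dz; apply: rnorm_eq0; apply/eqP; rewrite eq_le rnorm_ge0 andbT.
apply/ler_addgt0Pr => e e0; rewrite add0r.
have /closure_rnormP/(_ e e0)[_ -> ] : closure [set 0] (T z).
  by apply: closure_adjop Dz => y /D0 ->; exact: subset_closure.
by rewrite subr0; exact: ltW.
Qed.

Lemma closure_range_submodule T : closed_submodule (closure (range T)).
Proof.
split.
- exact: closed_closure.
- by apply: subset_closure; exists 0 => //; rewrite adjop0.
- move=> x y /closure_rnormP Tx /closure_rnormP Ty; apply/closure_rnormP => e e0.
  have e2 : 0 < e / 2 by rewrite divr_gt0.
  have [_ [u _ <-] xu] := Tx _ e2; have [_ [v _ <-] yv] := Ty _ e2.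
  exists (T (u + v)); first by exists (u + v).
  rewrite adjop_add (_ : _ - _ = (x - T u) + (y - T v)); last by zmod.
  by apply: le_lt_trans (rnormD _ _) _; lra.
- move=> k x; have sE y : k *: y = (k *: (1 : adjop H)) y by [].
  rewrite sE; apply: closure_adjop => _ [u _ <-].
  by apply: subset_closure; exists (k *: u) => //; rewrite adjopZ.
- move=> x a /closure_rnormP Tx; apply/closure_rnormP => e e0.
  have a0 : 0 < rnorm a + 1 by rewrite ltr_wpDl ?rnorm_ge0.
  have [|_ [u _ <-] xu] := Tx (e / (rnorm a + 1)); first by rewrite divr_gt0.
  exists (T (hact u a)); first by exists (hact u a).
  rewrite adjop_hact -scaleN1r -hactZl -hactDl scaleN1r.
  apply: le_lt_trans (rnorm_hact _ _) _; move: xu; rewrite ltr_pdivlMr //.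
  have := rnorm_ge0 (x - T u); lra.
Qed.

Lemma opbound_adj c T : 0 <= c -> opbound c T -> opbound (4 * c) (adj T).
Proof.
move=> c0 Tc x; have [/eqP Tx0|Tx0] := eqVneq (rnorm (adj T x)) 0.
  by move/eqP: Tx0 => ->; rewrite !mulr_ge0 ?rnorm_ge0.
have Tx : 0 < rnorm (adj T x) by rewrite lt_def Tx0 rnorm_ge0.
rewrite -(ler_pM2r Tx) -expr2 -rnorm_inner adjEr.
apply: le_trans (rnorm_inner_le _ _) _.
have : 4 * rnorm x * rnorm (T (adj T x)) <= 4 * rnorm x * (c * rnorm (adj T x)).
  by rewrite ler_wpM2l ?mulr_ge0 ?rnorm_ge0.
lra.
Qed.

Lemma cvg_of_dense c (V : nat -> adjop H) :
  0 <= c -> (forall n, opbound c (V n)) ->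
  (forall x e, 0 < e -> exists2 y, rnorm (x - y) < e &
     exists l : H, V n y @[n --> \oo] --> l) ->
  forall x, exists l : H, V n x @[n --> \oo] --> l.
Proof.
move=> c0 Vc Vd x; apply: rnorm_complete => e e0.
have c1 : 0 < c + 1 by rewrite ltr_wpDl.
have [|y xy [l /cvg_rnormP Vl]] := Vd x (e / 4 / (c + 1)); first by rewrite !divr_gt0.
have [|N VN] := Vl (e / 4); first by rewrite divr_gt0.
exists N => n /VN Vn; have {}VN := VN _ (leqnn N).
have -> : V n x - V N x = (V n (x - y) - V N (x - y)) + ((V n y - l) - (V N y - l)).
  by rewrite !adjopB; zmod.
apply: le_lt_trans (rnormD _ _) _.
apply: le_lt_trans (lerD (rnormB _ _) (rnormB _ _)) _.
have := Vc n (x - y); have := Vc N (x - y); move: xy; rewrite ltr_pdivlMr //.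
have := rnorm_ge0 (x - y); lra.
Qed.

Lemma cvg_rate (w : nat -> H) (l : H) c :
  (forall n, rnorm (w n - l) <= n.+1%:R^-1 * c) -> w @ \oo --> l.
Proof.
move=> wc; apply/cvg_rnormP => e e0.
have c0 : 0 <= c by have := le_trans (rnorm_ge0 _) (wc 0%N); rewrite invr1 mul1r.
have [N cN] : exists N, c / e < N%:R.
  by exists (Num.truncn (c / e)).+1; exact: truncnS_gt.
exists N => n Nn; apply: le_lt_trans (wc n) _.
rewrite mulrC ltr_pdivrMr // -ltr_pdivrMl // mulrC.
by apply: lt_le_trans cN _; rewrite ler_nat leqW.
Qed.

(** The operators [T * S n], where [S n] inverts [B + 1 / (n + 1)], are bounded
    approximations of the partial isometry of [T].  Boundedness comes
    from [adj (T S) * (T S) = (S B)^2] and [S B = 1 - S / (n + 1)], the limits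
    from the same identity. *)
Lemma cvg_near_polar T B (S : nat -> adjop H) :
  adj B = B -> B * B = adj T * T ->
  (forall n, [/\ S n * (B + homothety (n.+1%:R^-1)) = 1, adj (S n) = S n,
    opbound n.+1%:R^-1^-1 (S n) & B * S n = S n * B]) ->
  [/\ forall n, opbound 4 (T * S n),
      forall u, (T * S n) (B u) @[n --> \oo] --> T u,
      forall v n, T v = 0 -> (T * S n) v = 0 &
      forall u, adj (T * S n) (T u) @[n --> \oo] --> B u].
Proof.
move=> BB BT Sn; pose eps n : R := n.+1%:R^-1.
have eps0 n : 0 < eps n by rewrite invr_gt0.
have SB n : S n * B = 1 - (eps n)%:C *: S n.
  have [SE _ _ _] := Sn n; rewrite -[X in X - _]SE mulrDr -adjop_scalerAr mulr1.
  by rewrite addrK.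
have eS n : opbound 1 ((eps n)%:C *: S n).
  have [_ _ Sb _] := Sn n; have := opboundZ (eps n) Sb.
  by rewrite gtr0_norm // mulfV // gt_eqF.
have SB2 n : opbound 2 (S n * B).
  rewrite SB (_ : 2 = 1 + 1 :> R) //.
  by apply: opboundD; [exact: opbound1|exact: opboundN].
have TS n : opbound 4 (T * S n).
  move=> x; rewrite -(ler_pXn2r (_ : 0 < 2)%N) ?nnegrE ?mulr_ge0 ?rnorm_ge0 //.
  have [_ SA _ SC] := Sn n.
  rewrite -rnorm_inner adjE -[adj _ _]adjopME.
  have -> : adj (T * S n) * (T * S n) = (S n * B) * (S n * B).
    rewrite adjM SA mulrA -[_ * adj T * T]mulrA -BT -!mulrA; congr (_ * _).
    by rewrite SC.
  apply: le_trans (rnorm_inner_le _ _) _.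
  have : rnorm ((S n * B * (S n * B)) x) <= 2 * 2 * rnorm x.
    exact: (opboundM _ (SB2 n) (SB2 n)).
  have := rnorm_ge0 x => x0 le4.
  have : rnorm x * rnorm ((S n * B * (S n * B)) x) <= rnorm x * (2 * 2 * rnorm x).
    by rewrite ler_wpM2l.
  lra.
split=> //.
- move=> u; apply: (cvg_rate (c := 4 * rnorm u)) => n; rewrite -adjopME -mulrA SB.
  rewrite mulrBr mulr1 -adjop_scalerAr -adjopBE.
  rewrite (_ : _ - _ - T = - ((eps n)%:C *: (T * S n))); last by zmod.
  by rewrite adjopNE rnormN rnormZ gtr0_norm // ler_wpM2l ?(ltW (eps0 n)) //; exact: TS.
- move=> v n Tv.
  have Bv : B v = 0.
    apply: hinner_eq0; rewrite -{1}BB adjEr -adjopME BT adjopME Tv.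
    by rewrite adjop0 hinner0r.
  have : (S n * B) v = (1 - (eps n)%:C *: S n) v by rewrite SB.
  rewrite adjopME Bv adjop0 adjopBE adjopZE adjop1E => /esym/eqP.
  rewrite subr_eq0 => /eqP vE.
  rewrite adjopME; have : T v = (eps n)%:C *: T (S n v) by rewrite {1}vE adjopZ.
  rewrite Tv => /esym /(congr1 (fun w => ((eps n)^-1)%:C *: w)).
  by rewrite scalerA -rmorphM mulVf ?gt_eqF // scale1r scaler0.
- move=> u; apply: (cvg_rate (c := 2 * rnorm u)) => n; have [_ SA _ _] := Sn n.
  rewrite adjM SA -adjopME -mulrA -BT mulrA SB mulrBl mul1r -adjopBE.
  rewrite (_ : _ - _ - B = - (((eps n)%:C *: S n) * B)); last by zmod.
  rewrite adjopNE rnormN -adjop_scalerAl rnormZ gtr0_norm //.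
  by rewrite ler_wpM2l ?(ltW (eps0 n)) //; exact: SB2.
Qed.

(** The approximations of [cvg_near_polar] converge on [range B + ker T], and their
    adjoints on [range T + ker (adj T)].  Both are dense, the first because
    [range (adj T * T)] is dense in [range (adj T)], so the limit [U] exists and
    is adjointable.  It satisfies [U * B = T], [adj U * T = B] and vanishes on
    [ker T], whence [adj U * U] is the projection onto the closure of
    [range (adj T)]. *)
Lemma polar_of_dense T :
  (forall x e, 0 < e -> exists u v, adj T v = 0 /\ rnorm (x - (T u + v)) < e) ->
  (forall x e, 0 < e -> exists u v, T v = 0 /\ rnorm (x - (adj T u + v)) < e) ->
  has_polar_decomposition T.
Proof.
move=> dT dT'.
have [B [Bge0 BT _]] := nonneg_sqrt (nonneg_adjM T).
have BB := nonneg_adj Bge0.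
have [C [Cge0 CC _]] := nonneg_sqrt Bge0.
have dB x e : 0 < e -> exists u v, T v = 0 /\ rnorm (x - (B u + v)) < e.
  move=> e0; have e2 : 0 < e / 2 by rewrite divr_gt0.
  have [u [v [Tv xv]]] := dT' x _ e2; have [z] := range_adjM_dense (adj T) u e2.
  rewrite adjK -[adj T (T _)]adjopME -BT adjopME => uz.
  exists (B (adj T z)), v; split=> //.
  have -> : x - (B (B (adj T z)) + v) =
      (x - (adj T u + v)) + (adj T u - B (B (adj T z))) by zmod.
  by apply: le_lt_trans (rnormD _ _) _; lra.
have /choice[S Sn] : forall n, exists Sn : adjop H,
    [/\ Sn * (B + homothety (n.+1%:R^-1)) = 1, adj Sn = Sn,
        opbound n.+1%:R^-1^-1 Sn & B * Sn = Sn * B].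
  move=> n; have n0 : 0 < n.+1%:R^-1 :> R by rewrite invr_gt0.
  by have [Sn [? ? ? SC]] := resolvent Bge0 n0; exists Sn; split=> //; exact: SC.
have [Vb VB Vker VT] := cvg_near_polar BB BT Sn.
have Vc x : exists l : H, (T * S n) x @[n --> \oo] --> l.
  apply: (cvg_of_dense _ Vb) => // {}x e /(dB x)[u [v [Tv xuv]]].
  exists (B u + v) => //; exists (T u).
  have -> : (fun n => (T * S n) (B u + v)) = (fun n => (T * S n) (B u)).
    by apply/funext => n; rewrite adjop_add (Vker v) // addr0.
  exact: VB.
have Vc' x : exists l : H, adj (T * S n) x @[n --> \oo] --> l.
  have Vb' n : opbound (4 * 4) (adj (T * S n)) by exact: opbound_adj.
  apply: (cvg_of_dense _ Vb'); first by rewrite mulr_ge0.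
  move=> {}x e /(dT x)[u [v [Tv xuv]]].
  exists (T u + v) => //; exists (B u).
  have -> : (fun n => adj (T * S n) (T u + v)) = (fun n => adj (T * S n) (T u)).
    by apply/funext => n; rewrite adjop_add adjM [X in _ + X]adjopME Tv adjop0 addr0.
  exact: VT.
have [U [VU VU']] := adjop_limit Vc Vc'.
have UB : T = U * B.
  by apply: adjopP => u; exact: seq_cvg_unique (VB u) (VU (B u)).
have UT : adj U * T = B.
  by apply: adjopP => u; exact: seq_cvg_unique (VU' (T u)) (VT u).
have Uker v : T v = 0 -> U v = 0.
  move=> Tv; apply: seq_cvg_unique (VU v) _.
  have -> : (fun n => (T * S n) v) = (fun=> 0) by apply/funext => n; exact: Vker.
  exact: cvg_cst.
have TU : B = adj T * U by rewrite -BB -UT adjM adjK.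
have BU : adj T = B * adj U by rewrite {1}UB adjM BB.
pose E := adj U * U; have EA : adj E = E by rewrite adjM adjK.
have EB : E * B = B by rewrite /E -mulrA -UB.
have Efix z : closure (range (adj T)) z -> E z = z.
  move=> Tz; apply/eqP; rewrite -subr_eq0; apply/eqP.
  apply: (closure_ker (T := E - 1)) Tz => _ [u _ <-].
  by rewrite adjopBE -adjopME BU mulrA EB adjop1E subrr.
have Eran x : closure (range (adj T)) (E x).
  have [c c0 Ec] := adjop_bounded E.
  apply/closure_rnormP => e e0.
  have [|u [v [Tv xuv]]] := dB x (e / c); first by rewrite divr_gt0.
  exists (B u); first by exists (U u) => //; rewrite -adjopME -TU.
  have -> : E x - B u = E (x - (B u + v)).
    rewrite adjopB adjop_add -[E (B u)]adjopME EB.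
    by rewrite [E v]adjopME (Uker v Tv) adjop0 addr0.
  by apply: le_lt_trans (Ec _) _; move: xuv; rewrite ltr_pdivlMr // mulrC.
have EE : is_projection E.
  by split=> //; apply: adjopP => x; rewrite adjopME Efix.
exists U, B; split=> //.
  by split=> //; exists C; rewrite (nonneg_adj Cge0) CC.
split=> //; first exact: closure_range_submodule.
- move=> x; exists (E x), (x - E x); split=> //; last by rewrite addrC subrK.
  move=> y /Efix <-; rewrite -{1}EA adjEr adjopB -[E (E x)]adjopME.
  by case: EE => -> _; rewrite subrr hinner0r.
- by apply/seteqP; split=> [_ [x _ <-]//|z /Efix Ez]; exists z.
Qed.

End Polar.

(** * The submodule attached to a quasi-projection pair *)

Section QuasiProjection.
Context (R : realType) (A : cstarAlgType R) (H : hilbertModType A).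
Implicit Types (P Q T : adjop H) (x y z m u v : H).

(** Exchanging [(P, Q)] with [(1 - P, 1 - Q)] exchanges the two operators
    [P * (1 - Q)] and [(1 - P) * Q]; every statement about the first yields one
    about the second. *)
Lemma quasi_projection_pairC P Q :
  quasi_projection_pair P Q -> quasi_projection_pair (1 - P) (1 - Q).
Proof.
move=> [[PP PA] QQ [e1 e2 e3]]; rewrite /is_idempotent in PP QQ.
have idemC T : T * T = T -> (1 - T) * (1 - T) = 1 - T.
  by move=> TT; rewrite mulrBr mulr1 mulrBl mul1r TT subrr subr0.
split; first by split; [exact: idemC | rewrite adjB adj1 PA].
  exact: idemC.
rewrite subKr adjB adj1; split.
- by rewrite !(mulrBr (1 - P)) !mulr1 !(mulrBl (1 - P)) e3.
- have e2' : (1 - P) * adj Q * P = - ((1 - P) * Q * P).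
    have := congr1 (fun T => adj T) e2.
    by rewrite adjN !adjM adjB adj1 adjK PA !mulrA => ->; rewrite opprK.
  by rewrite !(mulrBr (1 - P)) !mulr1 !(mulrBl P) !mul1r !PP !subrr !sub0r e2'.
- by rewrite !(mulrBr P) !mulr1 !(mulrBl P) e1.
Qed.

(** The first column of [adj Q] in the block decomposition along [P]: the diagonal
    block is that of [Q], the off-diagonal block changes sign. *)
Lemma adj_mulP P Q : quasi_projection_pair P Q ->
  adj Q * P = P * Q * P + P * Q * P - Q * P.
Proof.
move=> [[_ PA] _ [e1 e2 _]].
have := congr1 (fun T => adj T) e2.
rewrite adjN !adjM adjB adj1 adjK PA !mulrA !mulrBl !mul1r e1 => e.
have -> : adj Q * P = P * Q * P - (- (adj Q * P - P * Q * P)) by zmod.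
by rewrite -e; zmod.
Qed.

(** The module of the theorem, described by its two components; in this form it
    is visibly closed. *)
Definition harmonic_part P Q : set H :=
  [set z | closure (range (P * (1 - Q))) (P z) /\
           closure (range ((1 - P) * Q)) ((1 - P) z)].

Lemma harmonic_partC P Q : harmonic_part (1 - P) (1 - Q) = harmonic_part P Q.
Proof. by rewrite /harmonic_part !subKr; apply/seteqP; split=> z []. Qed.

Lemma harmonic_part_submodule P Q : closed_submodule (harmonic_part P Q).
Proof.
have M1 := closure_range_submodule (P * (1 - Q)).
have M2 := closure_range_submodule ((1 - P) * Q).
split.
- by move=> z Mz; split; apply: (closure_adjop _ Mz) => y [].
- by split; rewrite adjop0; [exact: csub0 M1|exact: csub0 M2].
- by move=> x y [x1 x2] [y1 y2]; split; rewrite adjop_add;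
    [exact: (csubD M1 x1 y1)|exact: (csubD M2 x2 y2)].
- by move=> k x [x1 x2]; split; rewrite adjopZ;
    [exact: (csubZ M1 k x1)|exact: (csubZ M2 k x2)].
- by move=> x a [x1 x2]; split; rewrite adjop_hact;
    [exact: (csub_act M1 a x1)|exact: (csub_act M2 a x2)].
Qed.

Lemma closed_submoduleB (M : set H) x y :
  closed_submodule M -> M x -> M y -> M (x - y).
Proof.
by move=> hM Mx My; rewrite -scaleN1r; exact: (csubD hM Mx (csubZ hM _ My)).
Qed.

Lemma closure_range_adj_approx T z (e : R) : closure (range T) z -> 0 < e ->
  exists2 h, closure (range T) h & rnorm (z - T (adj T h)) < e.
Proof.
move=> /closure_rnormP Tz e0; have e2 : 0 < e / 2 by rewrite divr_gt0.
have [_ [u _ <-] zu] := Tz _ e2; have [w uw] := range_adjM_dense T u e2.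
exists (T w); first by apply: subset_closure; exists w.
rewrite -(subrKA (T u)); apply: le_lt_trans (rnormD _ _) _; lra.
Qed.

Section OneBlock.
Variables (P Q : adjop H).
Hypothesis PQ : quasi_projection_pair P Q.

Let PP : P * P = P. Proof. by case: PQ => -[]. Qed.
Let P'P : (1 - P) * P = 0. Proof. by rewrite mulrBl mul1r PP subrr. Qed.
Let M := harmonic_part P Q.
Let T1 := P * (1 - Q).
Let hM := harmonic_part_submodule P Q.

Lemma closure_range_ker z : closure (range T1) z -> (1 - P) z = 0.
Proof.
by apply: closure_ker => _ [u _ <-]; rewrite -adjopME /T1 mulrA P'P mul0r.
Qed.

Lemma closure_range_fix z : closure (range T1) z -> P z = z.
Proof.
by move/closure_range_ker/eqP; rewrite adjopBE adjop1E subr_eq0 => /eqP.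
Qed.

Lemma harmonic_part_range z : closure (range T1) z -> M z.
Proof.
move=> T1z; split; first by rewrite closure_range_fix.
by rewrite closure_range_ker //; exact: csub0 (closure_range_submodule _).
Qed.

Lemma harmonic_part_P z : M z -> M (P z).
Proof. by case=> Mz _; exact: harmonic_part_range. Qed.

(** Writing [T1 = P * (1 - Q)] and [T2 = (1 - P) * Q], one has
    [P Q T1 = T1 (1 - T1)] and [(1 - P) Q T1 = T2 T1]. *)
Lemma harmonic_part_Q_range z : closure (range T1) z -> M (Q z).
Proof.
move=> T1z; split.
  rewrite -adjopME; apply: closure_adjop T1z => _ [u _ <-].
  apply: subset_closure; exists ((1 - T1) u) => //; rewrite -!adjopME.
  congr (adjop_fun _ u); rewrite /T1 mulrBr mulr1.
  have -> : P * (1 - Q) * (P * (1 - Q)) = P * (1 - Q) - P * Q * (P * (1 - Q)).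
    by rewrite mulrA {1}[P * (1 - Q)]mulrBr mulr1 !mulrBl PP mulrA.
  by rewrite subKr.
rewrite -adjopME; apply: closure_adjop T1z => _ [u _ <-].
by apply: subset_closure; exists (T1 u).
Qed.

Lemma harmonic_part_adjQP z : M z -> M (Q (P z)) -> M (adj Q (P z)).
Proof.
move=> Mz MQ; rewrite -adjopME (adj_mulP PQ) adjopBE adjopDE -mulrA !adjopME.
apply: closed_submoduleB => //.
by apply: (csubD hM); exact: harmonic_part_P.
Qed.

End OneBlock.

Section BothBlocks.
Variables (P Q : adjop H).
Hypothesis PQ : quasi_projection_pair P Q.

Let PP : P * P = P. Proof. by case: PQ => -[]. Qed.
Let PA : adj P = P. Proof. by case: PQ => -[]. Qed.
Let QQ : Q * Q = Q. Proof. by case: PQ. Qed.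
Let PP' : P * (1 - P) = 0. Proof. by rewrite mulrBr mulr1 PP subrr. Qed.
Let Q'Q : (1 - Q) * Q = 0. Proof. by rewrite mulrBl mul1r QQ subrr. Qed.
Let PQ' := quasi_projection_pairC PQ.
Let M := harmonic_part P Q.
Let T1 := P * (1 - Q).
Let T2 := (1 - P) * Q.
Let hM := harmonic_part_submodule P Q.

Let T2E : (1 - P) * (1 - (1 - Q)) = T2. Proof. by rewrite subKr. Qed.

Let splitP z : z = P z + (1 - P) z.
Proof. by rewrite adjopBE adjop1E addrC subrK. Qed.

Lemma harmonic_part_range2 z : closure (range T2) z -> M z.
Proof.
by move=> T2z; rewrite /M -harmonic_partC; apply: (harmonic_part_range PQ'); rewrite T2E.
Qed.

Lemma harmonic_part_Q z : M z -> M (Q z).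
Proof.
move=> [M1 M2]; rewrite [z]splitP adjop_add; apply: (csubD hM).
  exact: (harmonic_part_Q_range PQ).
have -> : Q ((1 - P) z) = (1 - P) z - (1 - Q) ((1 - P) z).
  by rewrite [(1 - Q) _]adjopBE adjop1E subKr.
apply: closed_submoduleB => //; first exact: harmonic_part_range2.
by rewrite -harmonic_partC; apply: (harmonic_part_Q_range PQ'); rewrite T2E.
Qed.

Lemma harmonic_part_adjQ z : M z -> M (adj Q z).
Proof.
move=> Mz; have [M1 M2] := Mz; rewrite [z]splitP adjop_add; apply: (csubD hM).
  apply: (harmonic_part_adjQP PQ Mz).
  exact: (harmonic_part_Q_range PQ).
have -> : adj Q ((1 - P) z) = (1 - P) z - adj (1 - Q) ((1 - P) z).
  by rewrite adjB adj1 [(1 - adj Q) _]adjopBE adjop1E subKr.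
apply: closed_submoduleB => //; first exact: harmonic_part_range2.
rewrite -harmonic_partC; apply: (harmonic_part_adjQP PQ').
  by rewrite harmonic_partC.
by apply: (harmonic_part_Q_range PQ'); rewrite T2E.
Qed.

Lemma harmonic_part_adj_offdiag z : closure (range T1) z -> M (adj T1 z).
Proof.
move=> T1z; rewrite adjM PA adjopME (closure_range_fix PQ T1z) adjB adj1.
have Mz : M z by exact: (harmonic_part_range PQ).
by rewrite adjopBE adjop1E; apply: closed_submoduleB => //; exact: harmonic_part_adjQ.
Qed.

(** The component of [m] along [1 - P] is killed by [adj T1], and the other one is
    approximated by vectors [T1 (adj T1 h)] with [adj T1 h] in the module. *)
Lemma offdiag_range_dense m e : M m -> 0 < e ->
  exists u v, [/\ M u, M v, adj T1 v = 0 & rnorm (m - (T1 u + v)) < e].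
Proof.
move=> [M1 M2] e0; have [h T1h mh] := closure_range_adj_approx M1 e0.
exists (adj T1 h), ((1 - P) m); split.
- exact: harmonic_part_adj_offdiag.
- exact: harmonic_part_range2.
- by rewrite -adjopME adjM PA -mulrA PP' mulr0.
- by rewrite {1}[m]splitP (_ : _ - _ = P m - T1 (adj T1 h)) //; zmod.
Qed.

(** The key identity.  In blocks, with [a] the compression of [Q] by [P], it reads
    [1 - 3 a + 2 a^2 = (1 - 2 a) (1 - a)]: the operator [adj T1 - Q] maps the
    range of [P] into itself and acts there as [1 - 2 a], while [T1 * P] is
    [1 - a]. *)
Lemma offdiag_mul_adj : T1 * adj T1 = (adj T1 - Q) * (T1 * P).
Proof.
set a := P * Q * P.
have Pa : P * a = a by rewrite /a !mulrA PP.
have aP : a * P = a by rewrite /a -!mulrA PP.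
have T1P : T1 * P = P - a by rewrite /T1 mulrBr mulr1 mulrBl PP.
have T1E : adj T1 = P - (a + a - Q * P).
  by rewrite adjM PA adjB adj1 mulrBl mul1r adj_mulP.
have T1Q : T1 * (Q * P) = 0 by rewrite /T1 mulrA -[_ * Q]mulrA Q'Q mulr0 mul0r.
have T1a : T1 * a = a - a * a.
  rewrite {1}/T1 mulrBr mulr1 mulrBl Pa; congr (_ - _).
  by rewrite -[in LHS]Pa mulrA.
have QPa : Q * P * a = Q * a by rewrite -mulrA Pa.
rewrite T1P [in LHS]T1E !(mulrBr T1) (mulrDr T1) T1P T1a T1Q subr0.
rewrite T1E !(mulrBl, mulrBr, mulrDl, mulrDr) -[Q * P * P]mulrA.
by rewrite PP aP Pa QPa; zmod.
Qed.

Lemma offdiag_Q v : T1 (Q v) = 0.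
Proof. by rewrite -adjopME -mulrA Q'Q mulr0. Qed.

(** By [offdiag_mul_adj], a vector [T1 (adj T1 h)] is the sum of [adj T1 x] and
    [- Q x] for [x = T1 (P h)], and [T1] kills the range of [Q]. *)
Lemma offdiag_range_approx p (e : R) : closure (range T1) p -> 0 < e ->
  exists u v, [/\ M u, M v, T1 v = 0 & rnorm (p - (adj T1 u + v)) < e].
Proof.
move=> T1p e0; have [h T1h ph] := closure_range_adj_approx T1p e0.
pose x := T1 (P h).
have Mx : M x by apply: (harmonic_part_range PQ); apply: subset_closure; exists (P h).
exists x, (- Q x); split=> //.
- by rewrite -sub0r; apply: closed_submoduleB => //; [exact: csub0|exact: harmonic_part_Q].
- by rewrite adjopN offdiag_Q oppr0.
- suff -> : adj T1 x + - Q x = T1 (adj T1 h) by [].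
  by rewrite -[T1 (adj T1 h)]adjopME offdiag_mul_adj adjopME.
Qed.

End BothBlocks.

(** The component of [m] along [1 - P] is approximated by
    [T2 u = Q u - P (Q u)] with [u] in the module.  Here [Q u] lies in the kernel
    of [T1] and [P (Q u)] in the closure of its range, so [offdiag_range_approx]
    applied to [P m - P (Q u)] covers the rest. *)
Lemma offdiag_adj_range_dense P Q m (e : R) : quasi_projection_pair P Q ->
  let T1 := P * (1 - Q) in let M := harmonic_part P Q in
  M m -> 0 < e ->
  exists u v, [/\ M u, M v, T1 v = 0 & rnorm (m - (adj T1 u + v)) < e].
Proof.
move=> PQ T1 M Mm e0; have [M1 M2] := Mm; have hM := harmonic_part_submodule P Q.
have e2 : 0 < e / 2 by rewrite divr_gt0.
have [h T2h mh] := closure_range_adj_approx M2 e2.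
set T2 := (1 - P) * Q in T2h mh.
pose u := adj T2 h.
have Mu : M u.
  rewrite /M -harmonic_partC /u /T2 -[Q in adj (_ * Q)](subKr 1).
  by apply: (harmonic_part_adj_offdiag (quasi_projection_pairC PQ)); rewrite subKr.
have [MQ _] := harmonic_part_Q PQ Mu.
have T1p : closure (range T1) (P m - P (Q u)).
  exact: closed_submoduleB (closure_range_submodule _) _ _.
have [x [v [Mx Mv T1v pv]]] := offdiag_range_approx PQ T1p e2.
exists x, (v + Q u); split=> //.
- by apply: (csubD hM) => //; exact: harmonic_part_Q.
- by rewrite adjop_add T1v (offdiag_Q PQ) addr0.
- have -> : m - (adj T1 x + (v + Q u)) =
      (P m - P (Q u) - (adj T1 x + v)) + ((1 - P) m - T2 u).
    by rewrite /T2 adjopME !adjopBE !adjop1E; zmod.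
  by apply: le_lt_trans (rnormD _ _) _; rewrite /u; lra.
Qed.

End QuasiProjection.

(** * Restriction to a closed submodule *)

Section Restriction.
Context (R : realType) (A : cstarAlgType R) (H : hilbertModType A).
Variables (M : set H) (hM : closed_submodule M).
Implicit Types (S T : adjop H).

Lemma restriction_exists T :
  (forall z, M z -> M (T z)) -> (forall z, M z -> M (adj T z)) ->
  exists T' : adjop (csub hM), is_restriction T T' /\ is_restriction (adj T) (adj T').
Proof.
move=> TM TM'.
pose f (x : csub hM) : csub hM :=
  CSub (mem_set (TM _ (csubP x)) : _ \in in_csub hM).
pose g (x : csub hM) : csub hM :=
  CSub (mem_set (TM' _ (csubP x)) : _ \in in_csub hM).
have fg : is_adjoint f g by move=> x y; exact: adjE.
have fP : f \in @adjointable R A (csub hM) by apply/asboolP; exists g.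
exists (AdjOp fP); split=> // x.
suff -> : adj (AdjOp fP) x = g x by [].
by apply: hinner_inj => z; rewrite -adjE -fg.
Qed.

Lemma is_restrictionM S T (S' T' : adjop (csub hM)) :
  is_restriction S S' -> is_restriction T T' -> is_restriction (S * T) (S' * T').
Proof. by move=> SS TT x; rewrite !adjopME SS TT. Qed.

Lemma is_restrictionB S T (S' T' : adjop (csub hM)) :
  is_restriction S S' -> is_restriction T T' -> is_restriction (S - T) (S' - T').
Proof. by move=> SS TT x; rewrite !adjopBE -SS -TT. Qed.

Lemma is_restrictionN T (T' : adjop (csub hM)) :
  is_restriction T T' -> is_restriction (- T) (- T').
Proof. by move=> TT x; rewrite !adjopNE -TT. Qed.

Lemma is_restriction_inj T (S' T' : adjop (csub hM)) :
  is_restriction T S' -> is_restriction T T' -> S' = T'.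
Proof. by move=> TS TT; apply: adjopP => x; apply: val_inj => /=; rewrite TS TT. Qed.

(** [polar_of_dense] on the submodule, with the density hypotheses expressed in
    the ambient module. *)
Lemma polar_restriction T (T' : adjop (csub hM)) :
  is_restriction T T' -> is_restriction (adj T) (adj T') ->
  (forall m (e : R), M m -> 0 < e ->
     exists u v, [/\ M u, M v, adj T v = 0 & rnorm (m - (T u + v)) < e]) ->
  (forall m (e : R), M m -> 0 < e ->
     exists u v, [/\ M u, M v, T v = 0 & rnorm (m - (adj T u + v)) < e]) ->
  has_polar_decomposition T'.
Proof.
move=> TT TA dT dT'.
apply: polar_of_dense => x e e0.
  have [u [v [Mu Mv Tv xuv]]] := dT _ _ (csubP x) e0.
  exists (CSub (mem_set Mu : _ \in in_csub hM)), (CSub (mem_set Mv : _ \in in_csub hM)).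
  split; first by apply: val_inj; rewrite /= TA.
  by move: xuv; rewrite -(TT (CSub (mem_set Mu : _ \in in_csub hM))).
have [u [v [Mu Mv Tv xuv]]] := dT' _ _ (csubP x) e0.
exists (CSub (mem_set Mu : _ \in in_csub hM)), (CSub (mem_set Mv : _ \in in_csub hM)).
split; first by apply: val_inj; rewrite /= TT.
by move: xuv; rewrite -(TA (CSub (mem_set Mu : _ \in in_csub hM))).
Qed.

End Restriction.

(** * The restricted pair *)

Section Main.
Context (R : realType) (A : cstarAlgType R) (H : hilbertModType A).
Implicit Types (P Q T : adjop H).

Lemma harmonic_partE P Q : quasi_projection_pair P Q ->
  [set x + y | x in closure (range (P * (1 - Q))) & y in closure (range ((1 - P) * Q))]
  = harmonic_part P Q.
Proof.
move=> PQ; apply/seteqP; split=> [_ [x T1x [y T2y <-]]|z [T1z T2z]].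
  apply: (csubD (harmonic_part_submodule P Q)).
    exact: harmonic_part_range.
  exact: harmonic_part_range2.
exists (P z) => //; exists ((1 - P) z) => //.
by rewrite adjopBE adjop1E addrC subrK.
Qed.

Lemma quasi_projection_pair_restriction P Q (M : set H) (hM : closed_submodule M)
    (PM QM : adjop (csub hM)) :
  is_restriction P PM -> is_restriction (adj P) (adj PM) ->
  is_restriction Q QM -> is_restriction (adj Q) (adj QM) ->
  quasi_projection_pair P Q -> quasi_projection_pair PM QM.
Proof.
move=> rP rPA rQ rQA [[PP PA] QQ [e1 e2 e3]].
have rP' : is_restriction (1 - P) (1 - PM) by exact: is_restrictionB.
have rM S T (S' T' : adjop (csub hM)) := @is_restrictionM _ _ _ _ hM S T S' T'.
split; first split.
- by apply: is_restriction_inj (rM _ _ _ _ rP rP) _; rewrite PP.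
- by apply: is_restriction_inj rPA _; rewrite PA.
- by apply: is_restriction_inj (rM _ _ _ _ rQ rQ) _; rewrite QQ.
split.
- apply: (@is_restriction_inj _ _ _ _ _ (P * Q * P)); last by do 2! apply: (rM) => //.
  by rewrite -e1; do 2! apply: (rM) => //.
- apply: (@is_restriction_inj _ _ _ _ _ (- (P * Q * (1 - P)))).
    by rewrite -e2; do 2! apply: (rM) => //.
  by apply: is_restrictionN; do 2! apply: (rM) => //.
- apply: (@is_restriction_inj _ _ _ _ _ ((1 - P) * Q * (1 - P))).
    by rewrite -e3; do 2! apply: (rM) => //.
  by do 2! apply: (rM) => //.
Qed.

(** The submodule is a variable [M] equal to [harmonic_part P Q] so that the lemma
    also applies to the pair [(1 - P, 1 - Q)] on the same module. *)
Lemma harmonic_part_polar P Q (M : set H) (hM : closed_submodule M)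
    (PM QM : adjop (csub hM)) :
  M = harmonic_part P Q ->
  is_restriction P PM -> is_restriction (adj P) (adj PM) ->
  is_restriction Q QM -> is_restriction (adj Q) (adj QM) ->
  quasi_projection_pair P Q -> has_polar_decomposition (PM * (1 - QM)).
Proof.
move=> ME rP rPA rQ rQA PQ.
apply: (@polar_restriction _ _ _ _ _ (P * (1 - Q))).
- by apply: is_restrictionM => //; exact: is_restrictionB.
- rewrite !adjM !adjB !adj1.
  by apply: is_restrictionM => //; exact: is_restrictionB.
- by rewrite ME => m e; exact: offdiag_range_dense.
- by rewrite ME => m e; exact: offdiag_adj_range_dense.
Qed.

End Main.

Theorem theorem3p10 (R : realType) (A : cstarAlgType R) (H : hilbertModType A)
    (P Q : adjop H) :
  quasi_projection_pair P Q ->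
  let T1 := P * (1 - Q) in
  let T2 := (1 - P) * Q in
  let M := [set x + y | x in closure (range T1) & y in closure (range T2)] in
  exists (hM : closed_submodule M) (PM QM : adjop (csub hM)),
    [/\ is_restriction P PM, is_restriction Q QM & semi_harmonious PM QM].
Proof.
move=> PQ T1 T2 M; rewrite {}/M (harmonic_partE PQ).
have hM := harmonic_part_submodule P Q; exists hM.
have PA : adj P = P by case: PQ => -[].
have [PM [rP rPA]] : exists T' : adjop (csub hM),
    is_restriction P T' /\ is_restriction (adj P) (adj T').
  by apply: restriction_exists => z; rewrite ?PA; exact: harmonic_part_P.
have [QM [rQ rQA]] : exists T' : adjop (csub hM),
    is_restriction Q T' /\ is_restriction (adj Q) (adj T').
  by apply: restriction_exists => z; [exact: harmonic_part_Q|exact: harmonic_part_adjQ].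
exists PM, QM; split=> //; split.
- exact: quasi_projection_pair_restriction rP rPA rQ rQA PQ.
- exact: harmonic_part_polar rP rPA rQ rQA PQ.
- have -> : (1 - PM) * QM = (1 - PM) * (1 - (1 - QM)) by rewrite subKr.
  apply: (harmonic_part_polar (P := 1 - P) (Q := 1 - Q)).
  + by rewrite harmonic_partC.
  + exact: is_restrictionB.
  + by rewrite !adjB !adj1; exact: is_restrictionB.
  + exact: is_restrictionB.
  + by rewrite !adjB !adj1; exact: is_restrictionB.
  + exact: quasi_projection_pairC.
Qed.
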